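(* Let $\epsilon_0>0$ and $C_0>0$. There exists a constant $\delta_0=\delta_0(\epsilon_0,C_0)>0$ such that the following holds: if $d=(d_1,d_2,d_3):\mathbb R^2\to\mathbb S^2$ satisfies $\nabla d\in H^1(\mathbb R^2)$, $\|\nabla d\|_{L^2}\le C_0$ and $d_3\ge\epsilon_0$ on $\mathbb R^2$, then $$\|\nabla d\|_{L^4}^4\le(1-\delta_0)\|\Delta d\|_{L^2}^2.$$ Consequently, for such maps, $$\|\Delta d+|\nabla d|^2 d\|_{L^2}^2\ge\frac{\delta_0}{2}\Big(\|\Delta d\|_{L^2}^2+\|\nabla d\|_{L^4}^4\Big).$$
   Context: $\mathbb S^2$ is the unit sphere in $\mathbb R^3$; $|\nabla d|^2=\sum_{j=1}^2|\partial_j d|^2$. *)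

(* Defs.v *)
From HB Require Import structures.
From mathcomp Require Import all_boot all_order all_algebra.
From mathcomp Require Import all_classical all_reals all_analysis.
Set Implicit Arguments. Unset Strict Implicit. Unset Printing Implicit Defensive.
Import Order.TTheory GRing.Theory Num.Theory.
Import numFieldNormedType.Exports.
Local Open Scope classical_set_scope.
Local Open Scope ring_scope.

(* The plane R^2 is modelled as R * R, with Lebesgue measure
   (product of the one-dimensional Lebesgue measures). *)
Definition leb2 (R : realType) := (@lebesgue_measure R \x @lebesgue_measure R)%E.

Definition e2 (R : realType) (j : 'I_2) : R * R :=
  if j == ord0 then (1, 0) else (0, 1).

Definition pd (R : realType) (j : 'I_2) (f : R * R -> R) : R * R -> R :=
  fun x => 'D_(e2 R j) f x.

Fixpoint iter_pd (R : realType) (l : seq 'I_2) (f : R * R -> R) : R * R -> R :=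
  if l is j :: l' then pd j (iter_pd l' f) else f.

Definition smooth2 (R : realType) (f : R * R -> R) : Prop :=
  forall l : seq 'I_2, continuous (iter_pd l f) /\
    forall (j : 'I_2) (x : R * R), derivable (iter_pd l f) x (e2 R j).

Definition test_fun (R : realType) (phi : R * R -> R) : Prop :=
  smooth2 phi /\ compact (closure [set x | phi x != 0]).

Definition weak_pd (R : realType) (j : 'I_2) (f g : R * R -> R) : Prop :=
  forall phi, test_fun phi ->
    (\int[(@leb2 R)]_x ((f x * pd j phi x)%:E) = - \int[(@leb2 R)]_x ((g x * phi x)%:E))%E.

Definition L2 (R : realType) (f : R * R -> R) : Prop :=
  measurable_fun [set: R * R] f /\
  (\int[(@leb2 R)]_x ((f x ^+ 2)%:E) < +oo)%E.

(* Main.v *)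
Require Import Defs.
From HB Require Import structures.
From mathcomp Require Import all_boot all_order all_algebra.
From mathcomp Require Import all_classical all_reals all_analysis.
From mathcomp Require Import measurable_realfun ring lra.
Import Order.TTheory GRing.Theory Num.Theory.
Import numFieldNormedType.Exports.
Local Open Scope classical_set_scope.
Local Open Scope ring_scope.

(** Write [g_j], [h_jk] for the first and second derivatives of [d], put [e = |grad d|^2] and
    let [tau = lap d + e d] be the tension.  Differentiating [|d|^2 = 1] twice gives
    [<d, g_j> = 0] and [<d, h_jk> = - <g_j, g_k>], so [|lap d|^2 = |tau|^2 + e^2], and it
    suffices to bound the integral of [e^2] by a multiple of that of [|tau|^2].  Expand
      [0 <= sum_jk |h_jk + <g_j, g_k> d - (d_3)^-1 (d_k d_3) g_j|^2]:
    the Hessian terms integrate to those of [|lap d|^2] (null Lagrangian), the cross terms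
    together with [e (lap d_3) / d_3] form the divergence of [e (grad d_3) / d_3], and
    [lap d_3 = tau_3 - e d_3].  Since [sum_jk <g_j, g_k>^2 >= e^2 / 2], half of the integral of
    [e^2] survives, and the remaining term [e tau_3 / d_3] is absorbed using [d_3 >= eps0].

    The two integrations by parts are carried out with difference quotients: a function with
    an [L^2] weak derivative is an indefinite integral on almost every line, hence its
    difference quotients converge almost everywhere, with [L^2] and [L^4] norms bounded by
    those of the derivative.  This is exactly what the generalized dominated convergence
    theorem needs. *)

Set Implicit Arguments.
Unset Strict Implicit.

(** * Smooth test functions *)

Section Smooth1.
Context {R : realType}.
Implicit Types (f u v : R -> R) (C B : set (R -> R)) (x p q : R).

(** The vector h_jk + <g_j, g_k> d is the tangential part of the second derivative, so each expanded
    square is (d_3)^2 times the square of the tangential derivative of g_j / d_3. Dividing by d_3 is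
    the classical substitution by a positive solution: d_3 > 0 and lap d_3 + e d_3 = tau_3. The
    obstacle is low regularity on an unbounded domain: e (grad d_3) / d_3 is merely an integrable
    field built from first derivatives, with no decay given. Difference quotients meet both
    difficulties. Before the limit each integral vanishes exactly, by translation invariance and
    without a cut-off at infinity; in the limit the majorants are squares and fourth powers of
    quotients, whose integrals never exceed those of the derivatives. The fourth powers are
    integrable because of the constraint and not of a Sobolev embedding: e = - <d, lap d> gives e^2
    <= |lap d|^2. *)

Definition deriv_closed C :=
  forall f, C f -> exists2 f', C f' & forall x : R, is_derive x 1 f (f' x).

(* Smoothness as membership in some class closed under differentiation, which avoids
   iterated derivatives. *)
Definition smooth1 f := exists2 C, C f & deriv_closed C.

Lemma smooth1_closed : deriv_closed smooth1.
Proof.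
move=> f [C Cf hC]; have [f' Cf' hf'] := hC _ Cf.
by exists f' => //; exists C.
Qed.

Inductive span B : (R -> R) -> Prop :=
| span_base f : B f -> span B f
| span_add f g : span B f -> span B g -> span B (f \+ g).

(** Differentiating a product, or [flat_exp], yields a sum of functions of the same kind; closing a
    base under addition therefore gives a class closed under differentiation. *)
Lemma span_smooth1 B :
  (forall f, B f -> exists2 f', span B f' & forall x : R, is_derive x 1 f (f' x)) ->
  forall f, span B f -> smooth1 f.
Proof.
move=> hB f hf; exists (span B) => // {hf}f; elim=> [{}f /hB //|u v _ [u' su hu] _ [v' sv hv]].
exists (u' \+ v'); first exact: span_add.
by move=> x; exact: is_deriveD.
Qed.

Lemma smooth1M u v : smooth1 u -> smooth1 v -> smooth1 (u \* v).
Proof.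
move=> su sv.
apply: (@span_smooth1 [set f | exists a b, [/\ smooth1 a, smooth1 b & f = a \* b]]);
  last by apply: span_base; exists u, v.
move=> _ [a [b [sa sb ->]]].
have [a' sa' ha] := smooth1_closed sa; have [b' sb' hb] := smooth1_closed sb.
exists ((a \* b') \+ (b \* a')).
  by apply: span_add; apply: span_base; [exists a, b'|exists b, a'].
by move=> x; apply: is_derive_eq (is_deriveM (ha x) (hb x)) _.
Qed.

Lemma smooth1_affine u (c a b : R) : smooth1 u -> smooth1 (fun x => c * u (a * x + b)).
Proof.
move=> su.
(* The leading factor belongs to the class because the chain rule multiplies it by [a] each time. *)
exists [set f | exists c w, smooth1 w /\ f = (fun x => c * w (a * x + b))]; last first.
  move=> _ [{}c [w [sw ->]]]; have [w' sw' hw] := smooth1_closed sw.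
  exists (fun x => (c * a) * w' (a * x + b)); first by exists (c * a), w'.
  move=> x; have hd : is_derive x 1 (fun x => a * x + b) a.
    by apply: is_derive_eq; rewrite addr0 scaler1 //= [LHS]mulr1.
  have := hw (a * x + b) => hw'.
  have h := @is_derive1_comp _ w (fun x => a * x + b) x _ _ hw' hd.
  apply: is_derive_eq (@is_deriveZ _ _ _ _ c x 1 _ h) _.
  by rewrite -[LHS]/(_ * _) mulrA mulrAC.
by exists c, u.
Qed.

Lemma smooth1_primitive u P : smooth1 u -> (forall x : R, is_derive x 1 P (u x)) -> smooth1 P.
Proof.
move=> su hP; exists [set f | f = P \/ smooth1 f]; first by left.
move=> f [->|/smooth1_closed [f' sf' hf]]; first by exists u => //; right.
by exists f' => //; right.
Qed.

Lemma smooth1_add u v : smooth1 u -> smooth1 v -> smooth1 (u \+ v).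
Proof.
move=> su sv; apply: (@span_smooth1 smooth1); last by apply: span_add; apply: span_base.
by move=> f /smooth1_closed [f' sf' hf]; exists f' => //; exact: span_base.
Qed.

Lemma smooth1_continuous u : smooth1 u -> continuous u.
Proof.
move=> /smooth1_closed [u' _ hu] x.
by apply: differentiable_continuous; apply/derivable1_diffP; case: (hu x).
Qed.

(** For [k] = 0 this is the classical smooth function that is flat at the origin; the powers of 1/x
    are the factors produced by its derivatives. *)
Definition flat_exp (k : nat) (x : R) : R :=
  if 0 < x then x^-1 ^+ k * expR (- x^-1) else 0.

Lemma flat_exp_ge0 k x : 0 <= flat_exp k x.
Proof.
rewrite /flat_exp; case: ifPn => // x0.
by rewrite mulr_ge0 ?exprn_ge0 ?invr_ge0 ?ltW ?expR_gt0.
Qed.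

(** The term of order k + 2 in the series of exp (1/x) beats x^-k with two powers of x to spare; a
    quadratic bound is what makes the derivative at 0 vanish. *)
Lemma flat_exp_le k x : 0 <= x -> flat_exp k x <= (k.+2)`!%:R * x ^+ 2.
Proof.
move=> x0; rewrite /flat_exp; case: ifPn => [{}x0|_]; last by rewrite mulr_ge0 ?exprn_ge0.
have ix0 : 0 < x^-1 by rewrite invr_gt0.
have hx : x != 0 by rewrite gt_eqF.
have h : x^-1 ^+ k.+2 / (k.+2)`!%:R <= expR x^-1.
  by apply: le_trans (expR_ge1Dxn k.+1 (ltW ix0)); rewrite lerDr.
rewrite expRN ler_pdivrMr ?expR_gt0//.
have f0 : 0 < (k.+2)`!%:R :> R by rewrite ltr0n fact_gt0.
apply: le_trans (ler_wpM2l _ h); last by rewrite mulr_ge0 ?exprn_ge0 ?ltW.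
rewrite le_eqVlt; apply/orP; left; apply/eqP.
rewrite !exprS; field; by rewrite hx gt_eqF.
Qed.

Lemma flat_exp_derive k x :
  is_derive x 1 (flat_exp k) (flat_exp k.+2 x - k%:R * flat_exp k.+1 x).
Proof.
have [x0|x0|->] := ltgtP x 0.
- rewrite /flat_exp !ltNge !(ltW x0) /= mulr0 subr0.
  apply: (@near_eq_is_derive _ _ _ (cst 0)).
  near=> y; have y0 : y < 0 by near: y; exact: lt_nbhsl.
  by rewrite /flat_exp ltNge (ltW y0).
- have hx : x != 0 by rewrite gt_eqF.
  apply: (@near_eq_is_derive _ _ _ (fun x => x^-1 ^+ k * expR (- x^-1))).
  + near=> y; have y0 : 0 < y by near: y; exact: lt_nbhsr.
    by rewrite /flat_exp y0.
  + have hV : is_derive x 1 (fun y : R => y^-1) (- x ^- 2).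
      apply: DeriveDef; first by apply: (@derivableV _ _ id).
      by rewrite (@deriveV _ _ id)// derive_id [LHS]mulr1.
    have hX : is_derive x 1 (fun y : R => y^-1 ^+ k) (k%:R * x^-1 ^+ k.-1 * (- x ^- 2)).
      have -> : (fun y : R => y^-1 ^+ k) = (fun y : R => y^-1) ^+ k.
        by apply/funext => y; rewrite exprfctE.
      apply: is_derive_eq (@is_deriveX _ _ _ k x 1 _ hV) _.
      by rewrite -[LHS]/(_ * _) mulr_natl.
    have hE : is_derive x 1 (fun y : R => expR (- y^-1)) (expR (- x^-1) * x ^- 2).
      have h1 : is_derive x 1 (fun y : R => - y^-1) (x ^- 2).
        by apply: is_derive_eq (is_deriveN hV) _; rewrite opprK.
      exact: (is_derive1_comp (is_derive_expR _) h1).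
    apply: is_derive_eq (is_deriveM hX hE) _.
    rewrite /flat_exp x0 /= -![_ *: _]/(_ * _).
    case: k {hX} => [|k] /=; rewrite ?mul0r ?mulr0 ?subr0 ?addr0 !exprS ?expr0.
      by field.
    by move: (k.+1%:R) => z; field.
- rewrite /flat_exp ltxx mulr0 subr0 -/(flat_exp k).
  have h : h^-1 *: ((flat_exp k \o shift 0) (h *: (1:R)) - flat_exp k 0) @[h --> 0^'] --> (0:R).
    apply/cvgrPdist_le => e e0; near=> h.
    have h0 : h != 0 by near: h; exact: nbhs_dnbhs_neq.
    rewrite /= addr0 [h *: 1]mulr1 sub0r normrN /flat_exp ltxx subr0.
    case: ifPn => [hp|_]; last by rewrite scaler0 normr0 ltW.
    rewrite -[_ *: _]/(_ * _) ger0_norm; last first.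
      by rewrite mulr_ge0 ?invr_ge0 ?mulr_ge0 ?exprn_ge0 ?invr_ge0 ?(ltW hp) ?expR_ge0.
    have := flat_exp_le k (ltW hp); rewrite {1}/flat_exp hp => H.
    rewrite mulrC ler_pdivrMr//; apply: (le_trans H).
    rewrite expr2 mulrA ler_pM2r// mulrC -ler_pdivlMr ?ltr0n ?fact_gt0//.
    rewrite -(gtr0_norm hp); near: h; apply: dnbhs0_le.
    by rewrite divr_gt0 // ltr0n fact_gt0.
  have hc : cvg (h^-1 *: ((flat_exp k \o shift 0) (h *: (1:R)) - flat_exp k 0) @[h --> 0^']).
    by apply/cvg_ex; exists (0:R).
  apply: DeriveDef; first exact: hc.
  by apply: cvg_lim => //; exact: h.
Unshelve. all: by end_near. Qed.

Lemma flat_exp_smooth k : smooth1 (flat_exp k).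
Proof.
apply: (@span_smooth1 [set f | exists c k, f = fun x => c * flat_exp k x]); last first.
  by apply: span_base; exists 1, k; apply/funext => x; rewrite mul1r.
move=> _ [c [{}k ->]].
exists ((fun x => c * flat_exp k.+2 x) \+ (fun x => (- c * k%:R) * flat_exp k.+1 x)).
  by apply: span_add; apply: span_base; [exists c, k.+2|exists (- c * k%:R), k.+1].
move=> x; apply: is_derive_eq (@is_deriveZ _ _ _ _ c x 1 _ (flat_exp_derive k x)) _.
by rewrite /= -[LHS]/(_ * _); ring.
Qed.

(* As [m] grows, [plateau p q m] increases to the indicator function of [`]p, q[]. *)
Definition plateau (p q : R) (m : nat) (x : R) : R :=
  flat_exp 0 (m.+1%:R * (x - p)) * flat_exp 0 (m.+1%:R * (q - x)).

Lemma plateau_smooth p q m : smooth1 (plateau p q m).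
Proof.
have -> : plateau p q m = (fun x => 1 * flat_exp 0 (m.+1%:R * x + (- m.+1%:R * p))) \*
    (fun x => 1 * flat_exp 0 (- m.+1%:R * x + (m.+1%:R * q))).
  by apply/funext => x; rewrite /plateau /= !mul1r; congr (flat_exp _ _ * flat_exp _ _); ring.
by apply: smooth1M; apply: smooth1_affine; exact: flat_exp_smooth.
Qed.

Lemma plateau_out p q m x : ~~ (p < x < q) -> plateau p q m x = 0.
Proof.
rewrite negb_and /plateau /flat_exp !pmulr_rgt0 ?ltr0n// !subr_gt0.
by case/orP => /negbTE ->; rewrite ?mul0r ?mulr0.
Qed.

Lemma plateau_ge0 p q m x : 0 <= plateau p q m x.
Proof. by rewrite mulr_ge0 ?flat_exp_ge0. Qed.

Lemma plateau_le1 p q m x : plateau p q m x <= 1.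
Proof.
have h z : flat_exp 0 z <= 1.
  rewrite /flat_exp; case: ifPn => // z0.
  by rewrite expr0 mul1r expR_le1 oppr_le0 invr_ge0 ltW.
by rewrite mulr_ile1 ?flat_exp_ge0.
Qed.

Lemma plateau_cvg p q x : plateau p q m x @[m --> \oo] --> (\1_(`]p, q[%classic) x : R).
Proof.
rewrite indicE; case: (boolP (x \in _)) => [|]; last first.
  rewrite notin_setE /= in_itv /= => /negP h.
  rewrite (_ : (fun m => _) = cst 0); first exact: cvg_cst.
  by apply/funext => m; rewrite plateau_out.
rewrite inE /= in_itv /= => /andP[px xq].
have h (z : R) : 0 < z -> flat_exp 0 (m.+1%:R * z) @[m --> \oo] --> (1 : R).
  move=> z0.
  rewrite (_ : (fun m => _) = (fun m => expR (- (m.+1%:R^-1 * z^-1)))); last first.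
    apply/funext => m; rewrite /flat_exp pmulr_rgt0 ?ltr0n// z0 expr0 mul1r.
    by rewrite invfM.
  rewrite [X in _ --> X](_ : 1 = expR (- (0 * z^-1))); last by rewrite mul0r oppr0 expR0.
  apply: (@continuous_cvg _ _ _ _ _ _ expR); first exact: continuous_expR.
  by apply: cvgN; apply: cvgM; [exact: cvg_harmonic|exact: cvg_cst].
rewrite -[X in _ --> X](mulr1 1); apply: cvgM; apply: h; by rewrite subr_gt0.
Qed.

End Smooth1.

(** * Tensor products as test functions on the plane *)

Section TestFunctions.
Context {R : realType}.
Implicit Types (u v a b : R -> R) (x : R * R).

Definition tensor u v : R * R -> R := fun x => u x.1 * v x.2.

Lemma ord2P (j : 'I_2) : j = ord0 \/ j = ord_max.
Proof. by case: j => [[|[|//]] ?]; [left|right]; apply/val_inj. Qed.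

Lemma tensor_derive1 u v u' x : (forall t : R, is_derive t 1 u (u' t)) ->
  is_derive x (e2 R ord0) (tensor u v) (tensor u' v x).
Proof.
move=> hu; case: (hu x.1) => du eu.
have h : h^-1 *: ((tensor u v \o shift x) (h *: e2 R ord0) - tensor u v x)
    @[h --> 0^'] --> tensor u' v x.
  rewrite /tensor -eu (_ : (fun h => _) =
    (fun h => (h^-1 *: ((u \o shift x.1) (h *: 1) - u x.1)) * v x.2)).
    by apply: cvgM; [exact: du|exact: cvg_cst].
  apply/funext => h; rewrite /e2 /= [h *: 0]mulr0 add0r.
  by rewrite -![_ *: _]/(_ * _) -mulrA -mulrBl.
apply: DeriveDef; first by apply/cvg_ex; eexists; exact: h.
by apply: cvg_lim => //; exact: h.
Qed.

Lemma tensor_derive2 u v v' x : (forall t : R, is_derive t 1 v (v' t)) ->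
  is_derive x (e2 R ord_max) (tensor u v) (tensor u v' x).
Proof.
move=> hv; case: (hv x.2) => dv ev.
have h : h^-1 *: ((tensor u v \o shift x) (h *: e2 R ord_max) - tensor u v x)
    @[h --> 0^'] --> tensor u v' x.
  rewrite /tensor -ev (_ : (fun h => _) =
    (fun h => u x.1 * (h^-1 *: ((v \o shift x.2) (h *: 1) - v x.2)))).
    by apply: cvgM; [exact: cvg_cst|exact: dv].
  apply/funext => h; rewrite /e2 /= [h *: 0]mulr0 add0r.
  by rewrite -![_ *: _]/(_ * _) mulrCA -mulrBr.
apply: DeriveDef; first by apply/cvg_ex; eexists; exact: h.
by apply: cvg_lim => //; exact: h.
Qed.

Lemma tensor_pd1 u v u' : (forall t : R, is_derive t 1 u (u' t)) ->
  pd ord0 (tensor u v) = tensor u' v.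
Proof. by move=> hu; apply/funext => x; case: (tensor_derive1 v x hu). Qed.

Lemma tensor_pd2 u v v' : (forall t : R, is_derive t 1 v (v' t)) ->
  pd ord_max (tensor u v) = tensor u v'.
Proof. by move=> hv; apply/funext => x; case: (tensor_derive2 u x hv). Qed.

(** Every iterated partial derivative is again a tensor product of smooth factors, which reduces
    continuity and derivability to one variable. *)
Lemma tensor_smooth2 u v : smooth1 u -> smooth1 v -> smooth2 (tensor u v).
Proof.
move=> su sv.
have H l : exists a b, [/\ smooth1 a, smooth1 b & iter_pd l (tensor u v) = tensor a b].
  elim: l => [|j l [a [b [sa sb e]]]]; first by exists u, v.
  have [a' sa' ha] := smooth1_closed sa; have [b' sb' hb] := smooth1_closed sb.
  rewrite /= e; case: (ord2P j) => ->.
    by exists a', b; rewrite (tensor_pd1 _ ha).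
  by exists a, b'; rewrite (tensor_pd2 _ hb).
move=> l; have [a [b [sa sb ->]]] := H l; split.
  move=> x; apply: cvgM.
    by apply: (@cvg_comp _ _ _ fst a); [exact: cvg_fst|exact: smooth1_continuous].
  by apply: (@cvg_comp _ _ _ snd b); [exact: cvg_snd|exact: smooth1_continuous].
have [a' sa' ha] := smooth1_closed sa; have [b' sb' hb] := smooth1_closed sb.
move=> j x; case: (ord2P j) => ->.
  by case: (tensor_derive1 b x ha).
by case: (tensor_derive2 a x hb).
Qed.

Lemma tensor_test_fun u v (M : R) : smooth1 u -> smooth1 v ->
  (forall t : R, M < `|t| -> u t = 0) -> (forall t : R, M < `|t| -> v t = 0) ->
  test_fun (tensor u v).
Proof.
move=> su sv hu hv; split; first exact: tensor_smooth2.
have cc : compact (`[- M, M]%classic `*` `[- M, M]%classic : set (R * R)).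
  by apply: compact_setX; exact: segment_compact.
apply: (subclosed_compact _ cc); first exact: closed_closure.
have clo : closed (`[- M, M]%classic `*` `[- M, M]%classic : set (R * R)).
  by apply: compact_closed.
rewrite ((closure_id _).1 clo); apply: closureS.
move=> [s t] /= /eqP h; rewrite !in_itv /= -!ler_norml.
by split; rewrite leNgt; apply/negP => hl; apply: h; rewrite /tensor /= ?(hu _ hl) ?(hv _ hl) ?mul0r ?mulr0.
Qed.

End TestFunctions.

(** * Measure and integration *)

Section MeasurePreserving.
Context d (T : measurableType d) (R : realType) (mu : {measure set T -> \bar R}).
Implicit Types (phi : T -> T).

Definition mpres phi := measurable_fun [set: T] phi /\
  forall A, measurable A -> mu (phi @^-1` A) = mu A.

Lemma mpres_ge0_integral phi (f : T -> \bar R) : mpres phi ->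
  measurable_fun setT f -> (forall x, 0 <= f x)%E ->
  (\int[mu]_x f (phi x) = \int[mu]_x f x)%E.
Proof.
move=> [mphi hphi] mf f0.
rewrite -(@ge0_integral_pushforward _ _ _ _ _ _ mphi mu setT f)//.
by apply: eq_measure_integral => A mA _; exact: hphi.
Qed.

Lemma mpres_integral phi (f : T -> \bar R) : mpres phi ->
  measurable_fun setT f -> (\int[mu]_x f (phi x) = \int[mu]_x f x)%E.
Proof.
move=> mp mf; rewrite integralE [RHS]integralE.
rewrite -(mpres_ge0_integral mp (measurable_funepos mf) (funepos_ge0 _)).
rewrite -(mpres_ge0_integral mp (measurable_funeneg mf) (funeneg_ge0 _)).
by congr (_ - _)%E; apply: eq_integral => x _; rewrite ?funeposE ?funenegE.
Qed.

Lemma mpres_integrable phi (f : T -> \bar R) : mpres phi ->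
  mu.-integrable setT f -> mu.-integrable setT (fun x => f (phi x)).
Proof.
move=> mp /integrableP[mf foo]; apply/integrableP; split.
  by apply: (measurableT_comp mf); case: mp.
rewrite (@mpres_ge0_integral _ (fun x => `|f x|)%E)//.
exact: measurableT_comp.
Qed.

Lemma mpres_ae phi (P : T -> Prop) : mpres phi ->
  {ae mu, forall x, P x} -> {ae mu, forall x, P (phi x)}.
Proof.
move=> [mphi hphi] [N [mN N0 hN]]; exists (phi @^-1` N); split.
- by rewrite -[X in measurable X]setTI; exact: mphi.
- by rewrite hphi.
- by move=> x /= hx; apply: hN.
Qed.

End MeasurePreserving.

(** * Translations and the coordinate swap *)

Section Plane.
Context {R : realType}.
Notation leb := (@lebesgue_measure R).
Notation mu2 := (leb \x leb)%E.

Definition shR (t y : R) : R := y + t.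

Lemma shR_mpres (t : R) : mpres leb (shR t).
Proof.
have mt : measurable_fun setT (shR t) by exact: measurable_funD.
split => // A mA.
rewrite -[LHS]/(pushforward leb (shR t : _ -> measurableTypeR R) A).
apply/esym/lebesgue_measure_unique => //= _ [[a b]] _ <-.
rewrite /pushforward.
have -> : shR t @^-1` [set` `]a, b]] = [set` `]a - t, b - t]].
  by apply/seteqP; split => x /=; rewrite !in_itv /= /shR lerBrDr ltrBlDr.
rewrite !lebesgue_measure_itv/= !lte_fin ltrD2r.
by rewrite -!EFinD; congr (if _ then _%:E else _); ring.
Qed.

(** The image measure agrees with the product measure on rectangles, and these determine it. *)
Lemma mpres_prod (phi : R * R -> R * R) : measurable_fun setT phi ->
  (forall A B, measurable A -> measurable B ->
    mu2 (phi @^-1` (A `*` B)) = (leb A * leb B)%E) -> mpres mu2 phi.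
Proof.
move=> mphi h; split => // A mA.
rewrite -[LHS]/(pushforward mu2 (phi : _ -> (measurableTypeR R * measurableTypeR R)%type) A).
by apply/esym/product_measure_unique.
Qed.

Definition swapR (x : R * R) : R * R := (x.2, x.1).

Lemma swapR_mpres : mpres mu2 swapR.
Proof.
apply: mpres_prod; first exact: measurable_fun_pair.
move=> A B mA mB.
have -> : swapR @^-1` (A `*` B) = B `*` A.
  by apply/seteqP; split => -[x y] /= [].
by rewrite product_measure1E// muleC.
Qed.

Definition sh (j : 'I_2) (t : R) (x : R * R) : R * R :=
  if j == ord0 then (x.1 + t, x.2) else (x.1, x.2 + t).

Lemma sh_mpres j t : mpres mu2 (sh j t).
Proof.
have [m1 h1] := shR_mpres t.
rewrite /sh; case: (j == ord0); apply: mpres_prod.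
- by apply: measurable_fun_pair => //; exact: (measurableT_comp m1).
- move=> A B mA mB.
  rewrite (_ : _ @^-1` _ = (shR t @^-1` A) `*` B); last first.
    by apply/seteqP; split => -[x y] /= [].
  rewrite product_measure1E ?h1//.
  by rewrite -[X in measurable X]setTI; exact: m1.
- by apply: measurable_fun_pair => //; exact: (measurableT_comp m1).
- move=> A B mA mB.
  rewrite (_ : _ @^-1` _ = A `*` (shR t @^-1` B)); last first.
    by apply/seteqP; split => -[x y] /= [].
  rewrite product_measure1E ?h1//.
  by rewrite -[X in measurable X]setTI; exact: m1.
Qed.

End Plane.

(** * Limits of integrals under varying majorants *)

Section AeTools.
Context d (T : measurableType d) (R : realType) (mu : {measure set T -> \bar R}).

Lemma ae_countable (I : countType) (P : I -> T -> Prop) :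
  (forall i, {ae mu, forall x, P i x}) -> {ae mu, forall x, forall i, P i x}.
Proof.
move=> h.
have H : {ae mu, forall x, forall n : nat, if unpickle n is Some i then P i x else True}.
  by apply: ae_foralln => n; case: (unpickle n) => // ; exact: aeW.
by apply: filterS H => x hx i; have := hx (pickle i); rewrite pickleK.
Qed.

Lemma ae_and (P Q : T -> Prop) : {ae mu, forall x, P x} -> {ae mu, forall x, Q x} ->
  {ae mu, forall x, P x /\ Q x}.
Proof. by move=> hP hQ; apply: filterS2 hP hQ => x; split. Qed.

Lemma limn_einf_ub (u : (\bar R)^nat) (l : \bar R) :
  (forall n, u n <= l)%E -> (limn_einf u <= l)%E.
Proof.
move=> ul; rewrite limn_einf_lim; apply: lime_le; first exact: is_cvg_einfs.
by apply: nearW => n; apply: le_trans (ul n); apply: ereal_inf_lbound; exists n => /=.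
Qed.

(* Fatou's lemma applied to [G_ n + f_ n >= 0]. *)
Lemma generalized_fatou (f_ G_ : nat -> T -> R) (f G : T -> R) :
  (forall n, measurable_fun setT (f_ n)) -> (forall n, measurable_fun setT (G_ n)) ->
  measurable_fun setT f -> measurable_fun setT G ->
  {ae mu, forall x, f_ n x @[n --> \oo] --> f x} ->
  {ae mu, forall x, G_ n x @[n --> \oo] --> G x} ->
  (forall n x, `|f_ n x| <= G_ n x) -> (forall x, 0 <= G x) ->
  (forall n, \int[mu]_x (G_ n x)%:E <= \int[mu]_x (G x)%:E)%E ->
  (\int[mu]_x (G x)%:E < +oo)%E ->
  (forall n, \int[mu]_x (f_ n x)%:E = 0)%E ->
  [/\ forall n, mu.-integrable setT (EFin \o f_ n),
    mu.-integrable setT (EFin \o f) & (\int[mu]_x (f x)%:E <= 0)%E].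
Proof.
move=> mf_ mG_ mf mG cf cG fG G0 hG Goo hf.
have G_0 n x : 0 <= G_ n x by apply: le_trans (fG n x).
have iG : mu.-integrable setT (EFin \o G).
  apply/integrableP; split; first exact/measurable_EFinP.
  by rewrite (eq_integral (EFin \o G))// => x _ /=; rewrite ger0_norm.
have iG_ n : mu.-integrable setT (EFin \o G_ n).
  apply/integrableP; split; first exact/measurable_EFinP.
  rewrite (eq_integral (EFin \o G_ n)); last by move=> x _ /=; rewrite ger0_norm.
  exact: le_lt_trans (hG n) Goo.
have if_ n : mu.-integrable setT (EFin \o f_ n).
  apply: le_integrable (iG_ n) => //; first exact/measurable_EFinP.
  by move=> x _ /=; rewrite lee_fin (le_trans (fG n x))// ler_norm.
have fleG : {ae mu, forall x, `|f x| <= G x}.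
  apply: filterS2 cf cG => x cfx cGx.
  by apply: (ler_cvg_to (cvg_norm cfx) cGx); exact: nearW.
have if0 : mu.-integrable setT (EFin \o f).
  apply/integrableP; split; first exact/measurable_EFinP.
  apply: le_lt_trans Goo; apply: ae_ge0_le_integral => //.
  - by apply: measurableT_comp => //; exact/measurable_EFinP.
  - by move=> x _; rewrite lee_fin.
  - exact/measurable_EFinP.
  - by apply: filterS fleG => x h _; rewrite /= lee_fin.
split => //.
have F0 n x : 0 <= G_ n x + f_ n x.
  by rewrite -[f_ n x]opprK subr_ge0; apply: le_trans (fG n x); rewrite -normrN ler_norm.
have mF n : measurable_fun setT (fun x => (G_ n x + f_ n x)%:E).
  by apply/measurable_EFinP; exact: measurable_funD.
have := @fatou _ _ _ mu setT measurableT (fun n x => (G_ n x + f_ n x)%:E) mF.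
have H0 : forall (n : nat) (x : T), [set: T] x -> (0%R <= (G_ n x + f_ n x)%:E)%E.
  by move=> n x _; rewrite lee_fin.
move=> /(_ H0) {H0}.
rewrite (_ : (\int[mu]_x limn_einf _)%E = \int[mu]_x (G x + f x)%:E)%E; last first.
  apply: ae_eq_integral => //.
  - rewrite /limn_einf; apply: measurableT_comp => //.
    by apply: measurable_fun_limn_esup => n; apply: measurableT_comp.
  - by apply/measurable_EFinP; exact: measurable_funD.
  - apply: filterS2 cf cG => x cfx cGx _.
    have /cvg_limn_einf_sup [-> _] // : (G_ n x + f_ n x)%:E @[n --> \oo] --> (G x + f x)%:E.
    by apply: cvg_EFin; [exact: nearW|exact: cvgD].
have -> : (\int[mu]_x (G x + f x)%:E = \int[mu]_x (G x)%:E + \int[mu]_x (f x)%:E)%E.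
  exact: (integralD_EFin measurableT iG if0).
have bnd n : (\int[mu]_x (G_ n x + f_ n x)%:E <= \int[mu]_x (G x)%:E)%E.
  have -> : (\int[mu]_x (G_ n x + f_ n x)%:E = \int[mu]_x (G_ n x)%:E + \int[mu]_x (f_ n x)%:E)%E.
    exact: (integralD_EFin measurableT (iG_ n) (if_ n)).
  by rewrite hf adde0.
move=> /le_trans/(_ (limn_einf_ub bnd)).
have fG0 : (\int[mu]_x (G x)%:E)%E \is a fin_num by exact: (integrable_fin_num measurableT iG).
by rewrite -leeBrDl// subee.
Qed.

(** Difference quotients have no fixed majorant; convergence of [G_] with integrals bounded by that
    of the limit replaces it. The one-sided result is applied to [f_] and to its opposite. *)
Lemma lim_integral_eq0 (f_ G_ : nat -> T -> R) (f G : T -> R) :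
  (forall n, measurable_fun setT (f_ n)) -> (forall n, measurable_fun setT (G_ n)) ->
  measurable_fun setT f -> measurable_fun setT G ->
  {ae mu, forall x, f_ n x @[n --> \oo] --> f x} ->
  {ae mu, forall x, G_ n x @[n --> \oo] --> G x} ->
  (forall n x, `|f_ n x| <= G_ n x) -> (forall x, 0 <= G x) ->
  (forall n, \int[mu]_x (G_ n x)%:E <= \int[mu]_x (G x)%:E)%E ->
  (\int[mu]_x (G x)%:E < +oo)%E ->
  (forall n, \int[mu]_x (f_ n x)%:E = 0)%E ->
  mu.-integrable setT (EFin \o f) /\ (\int[mu]_x (f x)%:E = 0)%E.
Proof.
move=> mf_ mG_ mf mG cf cG fG G0 hG Goo hf.
have [i_ i1 l1] := generalized_fatou mf_ mG_ mf mG cf cG fG G0 hG Goo hf.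
have [_ _ l2] : [/\ forall n, mu.-integrable setT (EFin \o (\- f_ n)),
    mu.-integrable setT (EFin \o (\- f)) & (\int[mu]_x ((\- f) x)%:E <= 0)%E].
  apply: (@generalized_fatou (fun n => \- f_ n) G_ _ G) => //.
  - by move=> n; exact: measurableT_comp.
  - exact: measurableT_comp.
  - by apply: filterS cf => x; exact: cvgN.
  - by move=> n x; rewrite /= normrN.
  - move=> n; rewrite (eq_integral (fun x => - (f_ n x)%:E))%E//.
    by rewrite integralN ?hf ?oppe0//; exact: (integrable_add_def measurableT (i_ n)).
split => //; apply/eqP; rewrite eq_le l1 /=.
have e : (\int[mu]_x ((\- f) x)%:E = - \int[mu]_x (f x)%:E)%E.
  by rewrite -integralN//; exact: (integrable_add_def measurableT i1).
by rewrite -(oppeK (\int[mu]_x (f x)%:E)%E) -e oppe_ge0.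
Qed.

End AeTools.

Lemma dct_real d (T : measurableType d) (R : realType) (mu : {measure set T -> \bar R})
    (f_ : nat -> T -> R) (f g : T -> R) :
  (forall n, measurable_fun setT (f_ n)) -> measurable_fun setT f ->
  (forall x, f_ n x @[n --> \oo] --> f x) ->
  mu.-integrable setT (EFin \o g) -> (forall n x, `|f_ n x| <= g x) ->
  (\int[mu]_x (f_ n x)%:E @[n --> \oo] --> \int[mu]_x (f x)%:E)%E.
Proof.
move=> mf_ mf cf ig fg.
have [] := @dominated_convergence _ _ _ mu setT measurableT (fun n x => (f_ n x)%:E)
  (fun x => (f x)%:E) (EFin \o g) => //.
- by move=> n; exact/measurable_EFinP.
- exact/measurable_EFinP.
- by apply: aeW => x _; apply: cvg_EFin; [exact: nearW|exact: cf].
- by apply: aeW => x n _; rewrite lee_fin.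
Qed.

Lemma cvg_cst0_eq (R : realType) (l : \bar R) :
  (fun _ : nat => 0%E : \bar R) @ \oo --> l -> l = 0%E.
Proof. by move=> h; apply: (cvg_unique _ h); [exact: ereal_hausdorff|exact: cvg_cst]. Qed.

(** The interval contains [x], lies in the ball of radius [r], and is longer than r / 2, a quarter
    of the length of the ball: rational intervals thus shrink nicely to any point. *)
Lemma rat_interval_around (R : realType) (x r : R) : 0 < r -> exists pq : rat * rat,
  (x - r < ratr pq.1 < x) && (x + r / 2 < ratr pq.2 < x + r).
Proof.
move=> r0.
have [|p /[!in_itv]/= hp] := @rat_in_itvoo R (x - r) x; first by lra.
have [|q /[!in_itv]/= hq] := @rat_in_itvoo R (x + r / 2) (x + r); first by lra.
by exists (p, q); rewrite hp hq.
Qed.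

(** * Functions on the line *)

Section Line.
Context {R : realType}.
Notation leb := (@lebesgue_measure R).
Notation locint := (@locally_integrable R setT).
Implicit Types (f g c K : R -> R).

Lemma locint_measurable f : locint f -> measurable_fun setT f.
Proof. by case. Qed.

Lemma locint_itv f (a b : R) : locint f -> leb.-integrable `[a, b] (EFin \o f).
Proof.
case=> mf _ h; apply/integrableP; split.
  by apply/measurable_EFinP; exact: measurable_funTS.
by apply: h => //; exact: segment_compact.
Qed.

Lemma locint_mul f c (M B : R) : locint f -> measurable_fun setT c ->
  (forall x, `|c x| <= B) -> (forall x, M < `|x| -> c x = 0) ->
  leb.-integrable setT (fun x : R => (f x * c x)%:E).
Proof.
move=> lf mc cB cM.
have [mf _ _] := lf.
have B0 : 0 <= B by apply: le_trans (cB 0).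
have i1 : leb.-integrable setT ((EFin \o f) \_ `[- M, M]).
  apply: (@integrable_mkcond _ _ R leb `[- M, M]%classic (EFin \o f) (measurable_itv _)).1.
  exact: locint_itv.
apply: le_integrable (integrableZl measurableT B i1) => //.
  by apply/measurable_EFinP; exact: measurable_funM.
move=> x _; rewrite /= patchE; case: ifPn => [_|].
  by rewrite -EFinM lee_fin !normrM mulrC (ger0_norm B0) ler_wpM2r.
rewrite notin_setE /= in_itv /= -ler_norml => /negP; rewrite -ltNge => /cM ->.
by rewrite !mulr0.
Qed.

Lemma measurable_plateau (p q : R) m : measurable_fun setT (plateau p q m).
Proof.
by apply: continuous_measurable_fun; apply: smooth1_continuous; exact: plateau_smooth.
Qed.

Lemma plateau_norm_le1 (p q : R) m x : `|plateau p q m x| <= 1.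
Proof. by rewrite ger0_norm ?plateau_ge0 ?plateau_le1. Qed.

Lemma maxnorm_out (p q x : R) : Num.max `|p| `|q| < `|x| -> ~~ (p <= x <= q).
Proof.
move=> Mx; apply/negP => /andP[px xq]; move: Mx; rewrite ltNge => /negP; apply.
rewrite le_max; apply/orP; have [x0|x0] := leP 0 x.
  by right; rewrite (ger0_norm x0); apply: le_trans xq (ler_norm _).
by left; rewrite (ltr0_norm x0) -normrN; apply: le_trans (ler_norm _); rewrite lerN2.
Qed.

Lemma plateau_supp (p q : R) m x : Num.max `|p| `|q| < `|x| -> plateau p q m x = 0.
Proof.
move=> /maxnorm_out h; apply: plateau_out; apply: contra h => /andP[h1 h2].
by rewrite !ltW.
Qed.

(** Dominated convergence: the plateaus stay below the indicator of the open interval and tend to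
    it. *)
Lemma locint_int_itv_eq0 K (p q : R) : locint K ->
  (forall m, \int[leb]_x (K x * plateau p q m x)%:E = 0)%E ->
  (\int[leb]_(x in `]p, q[) (K x)%:E = 0)%E.
Proof.
move=> lK h; have [mK _ _] := lK.
have mI : measurable_fun setT (\1_(`]p, q[%classic) : R -> R) by [].
pose M := Num.max `|p| `|q|.
have iI : leb.-integrable setT (fun x : R => (K x * (\1_(`]p, q[%classic) x : R))%:E).
  apply: (@locint_mul _ _ M 1) => //.
    by move=> x; rewrite indicE; case: (_ \in _); rewrite ?normr1 ?normr0.
  move=> x /maxnorm_out/negP hx; rewrite indicE memNset//= in_itv/= => /andP[h1 h2].
  by apply: hx; rewrite !ltW.
have : (\int[leb]_x (K x * plateau p q m x)%:E)%E @[m --> \oo] -->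
    (\int[leb]_x (K x * (\1_(`]p, q[%classic) x : R))%:E)%E.
  apply: (dct_real _ _ _ (integrable_norm iI)).
  - by move=> m; apply: measurable_funM => //; exact: measurable_plateau.
  - exact: measurable_funM.
  - by move=> x; apply: cvgM; [exact: cvg_cst|exact: plateau_cvg].
  - move=> m x /=; rewrite normrM [in leRHS]normrM ler_wpM2l// indicE.
    case: (boolP (x \in _)) => [_|]; first by rewrite normr1 plateau_norm_le1.
    by rewrite notin_setE/= in_itv/= => /negP hx; rewrite plateau_out// normr0.
rewrite (_ : (fun m => _) = cst 0%E); last by apply/funext => m; rewrite h.
move=> /cvg_cst0_eq <-.
rewrite integral_mkcond; apply: eq_integral => x _; rewrite patchE indicE.
by case: ifPn => _; rewrite ?mulr1 ?mulr0.
Qed.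

(* Only countably many plateaus are used, so that the lemma applies to almost every slice
   of a function on the plane. *)
Lemma locint_ae_eq0 K : locint K ->
  (forall (p q : rat) m, \int[leb]_x (K x * plateau (ratr p) (ratr q) m x)%:E = 0)%E ->
  {ae leb, forall x, K x = 0}.
Proof.
move=> lK h.
have hE (x : R) (n : nat) : exists pq : rat * rat,
    (x - n.+1%:R^-1 < ratr pq.1 < x) && (x + n.+1%:R^-1 / 2 < ratr pq.2 < x + n.+1%:R^-1).
  by apply: rat_interval_around; rewrite invr_gt0.
pose pq x n := projT1 (cid (hE x n)).
have hpq x n := projT2 (cid (hE x n)); rewrite -/(pq _ _) in hpq.
pose E x n : set R := `]ratr (pq x n).1, ratr (pq x n).2[%classic.
have nice x : nicely_shrinking x (E x).
  split; first by move=> n; exact: measurable_itv.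
  exists (4, fun n => (n.+1%:R^-1)%:pos); split => //=.
  - exact: cvg_harmonic.
  - move=> n y; rewrite /E /ball /= in_itv/= ltr_norml => /andP[h1 h2].
    have /andP[/andP[a1 a2] /andP[a3 a4]] := hpq x n.
    rewrite -/(pq x n) in a1 a2 a3 a4.
    by move: n.+1%:R^-1 a1 a2 a3 a4 => r *; apply/andP; split; lra.
  - move=> n; rewrite lebesgue_measure_ball// /E lebesgue_measure_itv/= lte_fin.
    have /andP[/andP[a1 a2] /andP[a3 a4]] := hpq x n.
    have n0 : 0 < n.+1%:R^-1 :> R by rewrite invr_gt0.
    rewrite -/(pq x n) in a1 a2 a3 a4 *.
    move: n.+1%:R^-1 n0 a1 a2 a3 a4 => r *.
    rewrite ifT; last by lra.
    by rewrite -EFinB -EFinM lee_fin mulr2n; lra.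
apply: (@filterS _ _ (ae_filter_ringOfSetsType leb) _ _ _ (lebesgue_differentiation lK)) => x hx.
(* At a Lebesgue point [K x] is the limit of its means over the rational intervals [E x n], and all
   of these means are 0. *)
have := nice_lebesgue_differentiation nice lK hx.
rewrite (_ : (fun n => _) = cst 0%E).
  by move=> /cvg_cst0_eq [].
apply/funext => n; rewrite /E locint_int_itv_eq0 ?mule0//.
Qed.

End Line.

(** * Cut-offs, tensor products and integrals over sections *)

Section LineTools.
Context {R : realType}.
Notation leb := (@lebesgue_measure R).
Notation mu2 := (leb \x leb)%E.
Notation locint := (@locally_integrable R setT).
Implicit Types (f g c K u v : R -> R).

Definition cut (M : R) : R -> R := \1_(`[- M, M]%classic).

Lemma cut_in (M x : R) : `|x| <= M -> cut M x = 1.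
Proof. by move=> h; rewrite /cut indicE mem_set//= in_itv /= -ler_norml. Qed.

Lemma cut_out (M x : R) : M < `|x| -> cut M x = 0.
Proof.
by move=> h; rewrite /cut indicE memNset//= in_itv /= -ler_norml; apply/negP; rewrite -ltNge.
Qed.

Lemma cut_ge0 (M x : R) : 0 <= cut M x.
Proof. by rewrite /cut indicE. Qed.

Lemma cut_le1 (M x : R) : `|cut M x| <= 1.
Proof. by rewrite /cut indicE; case: (_ \in _); rewrite ?normr1 ?normr0. Qed.

Lemma measurable_cut M : measurable_fun setT (cut M).
Proof. exact: measurable_indic. Qed.

Lemma locint_cut f (M : R) : locint f -> leb.-integrable setT (fun x : R => (f x * cut M x)%:E).
Proof.
move=> lf; apply: (@locint_mul _ _ _ M 1 lf (measurable_cut M)); first exact: cut_le1.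
exact: cut_out.
Qed.

Lemma integrable_cut M : leb.-integrable setT (fun x : R => (cut M x)%:E).
Proof.
exact: integrable_indic_itv.
Qed.

(** A compact subset of the line lies in a symmetric interval, so testing on such intervals is
    enough. *)
Lemma locintP f : measurable_fun setT f ->
  (forall M : R, leb.-integrable setT (fun x : R => (f x * cut M x)%:E)) -> locint f.
Proof.
move=> mf h; split => //; first exact: openT.
move=> K _ cK.
have [M [_ hM]] := compact_bounded cK.
have {}hM x : K x -> `|x| <= M + 1 by apply: hM; rewrite ltrDl.
have /integrableP[m1 i1] := h (M + 1).
apply: le_lt_trans i1; rewrite integral_mkcond; apply: ge0_le_integral => //.
- by move=> x _; rewrite patchE; case: ifPn => // _; rewrite lee_fin.
- apply/(measurable_restrictT _ _).1; first exact: compact_measurable.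
  by apply/measurable_EFinP; apply: measurableT_comp => //; exact: measurable_funTS.
- exact: measurableT_comp.
- move=> x _; rewrite patchE; case: ifPn => [|_]; last by rewrite lee_fin.
  by rewrite inE => /hM hx; rewrite cut_in// mulr1.
Qed.

Lemma integrable_tensor u v : leb.-integrable setT (EFin \o u) ->
  leb.-integrable setT (EFin \o v) ->
  mu2.-integrable setT (fun z : R * R => (u z.1 * v z.2)%:E).
Proof.
move=> iu iv.
have mu_ : measurable_fun setT u by apply/measurable_EFinP; exact: (measurable_int _ iu).
have mv : measurable_fun setT v by apply/measurable_EFinP; exact: (measurable_int _ iv).
have mm : measurable_fun [set: R * R] (fun z : R * R => (u z.1 * v z.2)%:E).
  apply/measurable_EFinP; apply: measurable_funM.
    exact: (measurableT_comp mu_ (@measurable_fst _ _ _ _)).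
  exact: (measurableT_comp mv (@measurable_snd _ _ _ _)).
apply/(@integrable12ltyP _ _ _ _ _ leb leb _ mm).
have e x : (\int[leb]_y `|(u x * v y)%:E| = `|u x|%:E * \int[leb]_y `|(v y)%:E|)%E.
  under eq_integral do rewrite /= normrM EFinM.
  by rewrite ge0_integralZl//; apply/measurable_EFinP; exact: measurableT_comp.
under eq_integral do rewrite e.
rewrite ge0_integralZr//.
- apply: lte_mul_pinfty; first exact: integral_ge0.
    exact: (integrable_fin_num measurableT (integrable_abse iu)).
  by case/integrableP: iv.
- by apply/measurable_EFinP; exact: measurableT_comp.
- exact: integral_ge0.
Qed.

Lemma measurable_section_integral (h : R * R -> \bar R) : measurable_fun setT h ->
  measurable_fun [set: R] (fun x : R => \int[leb]_y h (x, y))%E.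
Proof.
move=> mh.
rewrite (_ : (fun x : R => _) = (fun x : R => \int[leb]_y h^\+ (x, y) - \int[leb]_y h^\- (x, y))%E).
  apply: emeasurable_funB.
    have H := @measurable_fun_fubini_tonelli_F _ _ _ _ _ leb _ (measurable_funepos mh).
    exact: H.
  have H := @measurable_fun_fubini_tonelli_F _ _ _ _ _ leb _ (measurable_funeneg mh).
  exact: H.
apply/funext => x; rewrite integralE; congr (_ - _)%E; apply: eq_integral => y _.
  by rewrite !funeposE.
by rewrite !funenegE.
Qed.

End LineTools.

(** * Increments as integrals of the weak derivative *)

Section Translation.
Context {R : realType}.
Notation leb := (@lebesgue_measure R).
Notation mu2 := (leb \x leb)%E.
Notation locint := (@locally_integrable R setT).
Implicit Types (f g c K u v : R -> R).

Lemma integrable_plateau (p q : R) m : leb.-integrable setT (EFin \o plateau p q m).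
Proof.
apply: le_integrable (integrable_cut (Num.max `|p| `|q|)) => //.
  by apply/measurable_EFinP; exact: measurable_plateau.
move=> x _; rewrite /= lee_fin; have [h|h] := leP `|x| (Num.max `|p| `|q|).
  by rewrite cut_in// normr1 plateau_norm_le1.
by rewrite plateau_supp// normr0.
Qed.

Definition plateau_prim (p q : R) m (x : R) : R :=
  (\int[leb]_(s in [set` `]-oo, x]]) plateau p q m s)%R.

Lemma plateau_prim_derive (p q : R) m (x : R) :
  is_derive x 1 (plateau_prim p q m) (plateau p q m x).
Proof.
have [||||d1 d2] := @continuous_FTC1 R (plateau p q m) -oo%O x (x + 1).
- by rewrite ltrDl.
- by apply: integrableS (integrable_plateau p q m).
- exact: ltNyr.
- by apply: smooth1_continuous; exact: plateau_smooth.
- by apply: DeriveDef; [exact: d1|rewrite -derive1E; exact: d2].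
Qed.

(* The derivative of this test function is the difference of a plateau and its translate,
   which turns the weak derivative into an identity for [f (x + t) - f x]. *)
Definition plateau_win (p q t : R) m (x : R) : R :=
  plateau_prim p q m x - plateau_prim p q m (x - t).

Lemma plateau_win_derive (p q t : R) m (x : R) :
  is_derive x 1 (plateau_win p q t m) (plateau p q m x - plateau p q m (x - t)).
Proof.
apply: is_deriveB; first exact: plateau_prim_derive.
have h : is_derive x 1 (fun y : R => y - t) 1.
  by apply: is_derive_eq; rewrite subr0.
have := @is_derive1_comp _ _ (fun y : R => y - t) x _ _ (plateau_prim_derive p q m (x - t)) h.
by rewrite mulr1.
Qed.

Lemma plateau_win_smooth (p q t : R) m : smooth1 (plateau_win p q t m).
Proof.
apply: smooth1_primitive (plateau_win_derive p q t m).
have -> : (fun x => plateau p q m x - plateau p q m (x - t)) =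
    plateau p q m \+ (fun x => -1 * plateau p q m (1 * x + - t)).
  by apply/funext => x; rewrite /= mulN1r mul1r.
apply: smooth1_add; first exact: plateau_smooth.
by apply: smooth1_affine; exact: plateau_smooth.
Qed.

(** Written as a convolution with the indicator of [0, t[, the window shows its sign, its bound and
    its support, and becomes the adjoint of [window_int]. *)
Lemma plateau_winE (p q t : R) m (x : R) : 0 <= t ->
  (plateau_win p q t m x)%:E =
  (\int[leb]_s (plateau p q m s * (\1_(`[0, t[%classic) (x - s) : R))%:E)%E.
Proof.
move=> t0; rewrite /plateau_win /plateau_prim Rintegral_itvB//; last 2 first.
- by apply: integrableS (integrable_plateau p q m).
- by rewrite bnd_simp; lra.
rewrite /Rintegral fineK; last first.
  by apply: integrable_fin_num => //; apply: integrableS (integrable_plateau p q m).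
rewrite integral_mkcond; apply: eq_integral => s _; rewrite patchE indicE.
have -> : (s \in [set` `]x - t, x]]) = (x - s \in `[0, t[%classic).
  by apply/idP/idP; rewrite !inE/= !in_itv/= => /andP[h1 h2]; apply/andP; split; lra.
by case: (_ \in _); rewrite ?mulr1 ?mulr0.
Qed.

Lemma plateau_win_out (p q t : R) m (x : R) : 0 <= t ->
  Num.max `|p| `|q| + t < `|x| -> plateau_win p q t m x = 0.
Proof.
move=> t0 hx; apply: EFin_inj; rewrite plateau_winE//.
rewrite integral0_eq// => s _.
rewrite indicE; case: (boolP (_ \in _)) => [|_]; last by rewrite mulr0.
rewrite inE/= in_itv/= => /andP[h1 h2]; rewrite plateau_supp ?mul0r//.
have : `|x| <= `|s| + `|x - s| by rewrite -{1}(subrKC s x) ler_normD.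
rewrite (ger0_norm h1) => h3; lra.
Qed.

Lemma plateau_win_bounded (p q t : R) m : 0 <= t ->
  exists B : R, forall x, `|plateau_win p q t m x| <= B.
Proof.
move=> t0; have ip := integrable_plateau p q m.
exists (fine (\int[leb]_s (plateau p q m s)%:E)%E) => x.
have h0 : (0 <= (plateau_win p q t m x)%:E)%E.
  rewrite plateau_winE//; apply: integral_ge0 => s _.
  by rewrite lee_fin mulr_ge0 ?plateau_ge0// indicE.
rewrite ger0_norm// -lee_fin fineK; last exact: (integrable_fin_num measurableT ip).
rewrite plateau_winE//; apply: ge0_le_integral => //.
- by move=> s _; rewrite lee_fin mulr_ge0 ?plateau_ge0// indicE.
- apply/measurable_EFinP; apply: measurable_funM; first exact: measurable_plateau.
  apply: measurableT_comp; first exact: measurable_indic.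
  by apply: measurable_funB.
- exact: (measurable_int _ ip).
- move=> s _; rewrite lee_fin ler_piMr ?plateau_ge0// indicE.
Qed.

(** When [g] is the weak derivative of [f], this will be the increment of [f] from x to x + t. *)
Definition window_int g (t x : R) : R := (\int[leb]_(s in `[x, (x + t)%R[) g s)%R.

Lemma measurable_window (t : R) :
  measurable_fun [set: R * R] (fun z : R * R => \1_(`[0, t[%classic) (z.2 - z.1) : R).
Proof.
apply: (@measurableT_comp _ _ _ _ _ _ (\1_(`[0, t[%classic) : R -> R)).
  exact: measurable_indic.
by apply: measurable_funB.
Qed.

Lemma window_intE g (t x : R) : locint g -> 0 <= t ->
  (window_int g t x)%:E = (\int[leb]_s (g s * (\1_(`[0, t[%classic) (s - x) : R))%:E)%E.
Proof.
move=> lg t0; rewrite /window_int /Rintegral fineK; last first.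
  apply: integrable_fin_num => //; apply: integrableS (locint_itv x (x + t) lg) => //.
  by move=> y /=; rewrite !in_itv/= => /andP[-> /ltW].
rewrite integral_mkcond; apply: eq_integral => s _; rewrite patchE indicE.
have -> : (s \in [set` `[x, (x + t)%R[]) = (s - x \in `[0, t[%classic).
  by apply/idP/idP; rewrite !inE/= !in_itv/= => /andP[h1 h2]; apply/andP; split; lra.
by case: (_ \in _); rewrite ?mulr1 ?mulr0.
Qed.

Lemma window_integrable c g (t M B : R) : locint g -> 0 <= t -> measurable_fun setT c ->
  (forall x, `|c x| <= B) -> (forall x, M < `|x| -> c x = 0) ->
  mu2.-integrable setT
    (fun z : R * R => (c z.1 * (g z.2 * (\1_(`[0, t[%classic) (z.2 - z.1) : R)))%:E).
Proof.
move=> lg t0 mc cB cM.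
have mg := locint_measurable lg.
have B0 : 0 <= B by apply: le_trans (cB 0).
have ic : leb.-integrable setT (EFin \o c).
  apply: le_integrable (integrableZl measurableT B (integrable_cut M)) => //.
    exact/measurable_EFinP.
  move=> x _; rewrite /= lee_fin; have [h|h] := leP `|x| M.
    by rewrite cut_in// mulr1 (ger0_norm B0).
  by rewrite cM// normr0.
apply: le_integrable (integrable_tensor ic (locint_cut (M + t) lg)) => //.
  apply/measurable_EFinP; apply: measurable_funM.
    exact: (measurableT_comp mc (@measurable_fst _ _ _ _)).
  apply: measurable_funM; last exact: measurable_window.
  exact: (measurableT_comp mg (@measurable_snd _ _ _ _)).
move=> [x s] _ /=; rewrite lee_fin; have [h|h] := leP `|x| M; last by rewrite cM// !mul0r.
rewrite indicE; case: (boolP (_ \in _)) => [|_]; last by rewrite !mulr0 normr0.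
rewrite inE/= in_itv/= => /andP[h1 h2]; rewrite cut_in//.
have : `|s| <= `|x| + `|s - x| by rewrite -{1}(subrKC x s) ler_normD.
by rewrite (ger0_norm h1) => h3; lra.
Qed.

Lemma window_section_integrable g (t x : R) : locint g -> 0 <= t ->
  leb.-integrable setT (fun s : R => (g s * (\1_(`[0, t[%classic) (s - x) : R))%:E).
Proof.
move=> lg t0; apply: (@locint_mul _ _ _ (`|x| + t) 1 lg).
- apply: (@measurableT_comp _ _ _ _ _ _ (\1_(`[0, t[%classic) : R -> R)).
    exact: measurable_indic.
  exact: measurable_funB.
- by move=> s; rewrite indicE; case: (_ \in _); rewrite ?normr1 ?normr0.
- move=> s hs; rewrite indicE memNset//= in_itv/= => /andP[h1 h2].
  have : `|s| <= `|x| + `|s - x| by rewrite -{1}(subrKC x s) ler_normD.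
  by rewrite (ger0_norm h1) => h3; lra.
Qed.

Lemma window_int_locint g (t : R) : locint g -> 0 <= t -> locint (window_int g t).
Proof.
move=> lg t0; have mg := locint_measurable lg.
have mh : measurable_fun [set: R * R]
    (fun z : R * R => (g z.2 * (\1_(`[0, t[%classic) (z.2 - z.1) : R))%:E).
  apply/measurable_EFinP; apply: measurable_funM; last exact: measurable_window.
  exact: (measurableT_comp mg (@measurable_snd _ _ _ _)).
apply: locintP.
  apply/measurable_EFinP.
  rewrite (_ : EFin \o _ = fun x : R => (\int[leb]_s
     (g (x, s).2 * (\1_(`[0, t[%classic) ((x, s).2 - (x, s).1) : R))%:E)%E).
    exact: (measurable_section_integral mh).
  by apply/funext => x; rewrite /= window_intE.
move=> M.
have := integrable_fubini_F (window_integrable lg t0 (measurable_cut M) (cut_le1 M) (@cut_out _ M)).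
apply: eq_integrable => // x _; rewrite /fubini_F /= [in RHS]mulrC EFinM window_intE//.
rewrite -integralZl//; exact: window_section_integrable.
Qed.

Lemma integral_mul_shift f c (t : R) : measurable_fun setT f -> measurable_fun setT c ->
  (\int[leb]_x (f (x + t)%R * c x)%:E = \int[leb]_x (f x * c (x - t)%R)%:E)%E.
Proof.
move=> mf mc; rewrite -[RHS](mpres_integral (shR_mpres t)); last first.
  apply/measurable_EFinP; apply: measurable_funM => //.
  by apply: (measurableT_comp mc); exact: measurable_funB.
by apply: eq_integral => x _; rewrite /shR addrK.
Qed.

Lemma locint_shift f (t : R) : locint f -> locint (fun x => f (x + t)).
Proof.
move=> lf; have mf := locint_measurable lf.
apply: locintP.
  by apply: (measurableT_comp mf); exact: measurable_funD.
move=> M; have := mpres_integrable (shR_mpres t) (@locint_mul _ _ (fun x => cut M (x - t)) (M + `|t|) 1 lf _ _ _).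
rewrite /shR => H; apply: eq_integrable (H _ _ _) => //.
- by move=> x _ /=; rewrite addrK.
- apply: (measurableT_comp (measurable_cut M)); exact: measurable_funB.
- by move=> x; exact: cut_le1.
- move=> x hx; apply: cut_out.
  have : `|x| <= `|x - t| + `|t| by rewrite -{1}(subrK t x) ler_normD.
  by move=> h; lra.
Qed.

(** Fubini: both sides integrate the same kernel, the indicator of [0, t[ at s - x, in the two
    possible orders. *)
Lemma integral_window_int_plateau g (p q t : R) m : locint g -> 0 <= t ->
  (\int[leb]_x (window_int g t x * plateau p q m x)%:E =
   \int[leb]_s (g s * plateau_win p q t m s)%:E)%E.
Proof.
move=> lg t0.
have iF := window_integrable lg t0 (measurable_plateau p q m) (plateau_norm_le1 p q m)
  (fun x => @plateau_supp _ p q m x).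
have := Fubini iF.
under eq_integral.
  move=> x _.
  under eq_integral do rewrite /= EFinM.
  rewrite integralZl//; last exact: window_section_integrable.
  rewrite -window_intE// -EFinM mulrC.
  over.
move=> ->; apply: eq_integral => s _.
under eq_integral do rewrite /= mulrCA EFinM.
rewrite integralZl//; last first.
  apply: le_integrable (integrable_plateau p q m) => //.
    apply/measurable_EFinP; apply: measurable_funM; first exact: measurable_plateau.
    apply: (@measurableT_comp _ _ _ _ _ _ (\1_(`[0, t[%classic) : R -> R)).
      exact: measurable_indic.
    exact: measurable_funB.
  move=> x _ /=; rewrite lee_fin normrM ler_piMr// indicE.
  by case: (_ \in _); rewrite ?normr1 ?normr0.
by rewrite -plateau_winE// -EFinM.
Qed.

(** Tested against a plateau, the terms of [K] cancel: the translation passes to the plateau, the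
    window integral becomes an integral of [g] against [plateau_win], and the hypothesis turns the
    latter back into [f] times the difference of plateaus. *)
Lemma translation_identity f g (t : R) : locint f -> locint g -> 0 <= t ->
  (forall (p q : rat) m,
    \int[leb]_x (f x * (plateau (ratr p) (ratr q) m x - plateau (ratr p) (ratr q) m (x - t)%R))%:E
    = - \int[leb]_x (g x * plateau_win (ratr p) (ratr q) t m x)%:E)%E ->
  {ae leb, forall x, f (x + t) - f x = window_int g t x}.
Proof.
move=> lf lg t0 h.
have mf := locint_measurable lf.
have lG := window_int_locint lg t0.
have lft := locint_shift t lf.
pose K x := f (x + t) - f x - window_int g t x.
have lK : locint K by apply: locally_integrableB => //; apply: locally_integrableB.
suff : {ae leb, forall x, K x = 0}.
  apply: (@filterS _ _ (ae_filter_ringOfSetsType leb)) => x /eqP.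
  by rewrite /K subr_eq0 => /eqP.
apply: locint_ae_eq0 => // p q m.
set a := plateau (ratr p) (ratr q) m.
have ma : measurable_fun setT a by exact: measurable_plateau.
have i0 u : locint u -> leb.-integrable setT (fun x : R => (u x * a x)%:E).
  move=> lu; apply: (@locint_mul _ _ _ (Num.max `|ratr p| `|ratr q|) 1 lu ma).
    exact: plateau_norm_le1.
  by move=> x; exact: plateau_supp.
have i3 : leb.-integrable setT (fun x : R => (f x * a (x - t))%:E).
  apply: (@locint_mul _ _ _ (Num.max `|ratr p| `|ratr q| + t) 1 lf).
  - by apply: (measurableT_comp ma); exact: measurable_funB.
  - by move=> x; exact: plateau_norm_le1.
  - move=> x hx; apply: plateau_supp.
    have : `|x| <= `|x - t| + `|t| by rewrite -{1}(subrK t x) ler_normD.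
    by rewrite (ger0_norm t0) => h3; lra.
have -> : (\int[leb]_x (K x * a x)%:E = \int[leb]_x ((f (x + t)%R * a x)%:E - (f x * a x)%:E)
     - \int[leb]_x (window_int g t x * a x)%:E)%E.
  rewrite -integralB//; last 2 first.
  - apply: integrableB => //; [exact: (i0 _ lft)|exact: i0].
  - exact: i0.
  by apply: eq_integral => x _; rewrite /K -!EFinB !mulrBl.
rewrite integralB//; [|exact: (i0 _ lft)|exact: i0].
rewrite integral_window_int_plateau//.
have := h p q m; rewrite -/a => {}h.
rewrite integral_mul_shift//.
have -> : (\int[leb]_x (g x * plateau_win (ratr p) (ratr q) t m x)%:E =
    - \int[leb]_x (f x * (a x - a (x - t)%R))%:E)%E by rewrite h oppeK.
have -> : (\int[leb]_x (f x * (a x - a (x - t)%R))%:E =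
    \int[leb]_x (f x * a x)%:E - \int[leb]_x (f x * a (x - t)%R)%:E)%E.
  rewrite -integralB//; last exact: i0.
  by apply: eq_integral => x _; rewrite -EFinB mulrBr.
have f1 : (\int[leb]_x (f x * a x)%:E)%E \is a fin_num by apply: (integrable_fin_num measurableT); exact: i0.
have f2 : (\int[leb]_x (f x * a (x - t)%R)%:E)%E \is a fin_num by apply: (integrable_fin_num measurableT).
have H (x y : \bar R) : x \is a fin_num -> y \is a fin_num -> (y - x - - (x - y) = 0)%E.
  by move: x y => [x||] [y||]// _ _; apply: (congr1 EFin (x := y - x - - (x - y)) (y := 0)); ring.
exact: H f1 f2.
Qed.

End Translation.

(** The variance of [g] about its mean [c], over the set of measure [t] where [w] = 1, is
    nonnegative. If the integral on the right is infinite there is nothing to prove. *)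
Lemma jensen_sq d (T : measurableType d) (R : realType) (mu : {measure set T -> \bar R})
    (w g : T -> R) (t : R) : 0 < t -> measurable_fun setT w -> measurable_fun setT g ->
  (forall x, w x = 0 \/ w x = 1) -> (\int[mu]_x (w x)%:E = t%:E)%E ->
  mu.-integrable setT (fun x => (g x * w x)%:E) ->
  (((t^-1 * fine (\int[mu]_x (g x * w x)%:E)) ^+ 2)%:E <=
    t^-1%:E * \int[mu]_x (g x ^+ 2 * w x)%:E)%E.
Proof.
move=> t0 mw mg w01 wt ig.
have w0 x : 0 <= w x by case: (w01 x) => ->.
have m2 : measurable_fun setT (fun x => (g x ^+ 2 * w x)%:E).
  by apply/measurable_EFinP; apply: measurable_funM => //; exact: measurable_funX.
have p2 x : (0 <= (g x ^+ 2 * w x)%:E)%E by rewrite lee_fin mulr_ge0 ?sqr_ge0.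
have [Joo|Jfin] := eqVneq (\int[mu]_x (g x ^+ 2 * w x)%:E)%E +oo%E.
  by rewrite Joo gt0_muley ?leey// lte_fin invr_gt0.
have i2 : mu.-integrable setT (fun x => (g x ^+ 2 * w x)%:E).
  apply/integrableP; split => //.
  by under eq_integral do rewrite gee0_abs//; rewrite ltey.
have iw : mu.-integrable setT (fun x => (w x)%:E).
  apply/integrableP; split; first exact/measurable_EFinP.
  by under eq_integral do rewrite gee0_abs ?lee_fin//; rewrite wt ltry.
set I := fine _; set c := t^-1 * I.
have hI : (\int[mu]_x (g x * w x)%:E)%E = I%:E.
  by rewrite /I fineK//; exact: (integrable_fin_num measurableT ig).
have [J hJ] : exists J, (\int[mu]_x (g x ^+ 2 * w x)%:E)%E = J%:E.
  by exists (fine (\int[mu]_x (g x ^+ 2 * w x)%:E)%E); rewrite fineK//; exact: (integrable_fin_num measurableT i2).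
have : (0 <= \int[mu]_x ((g x - c) ^+ 2 * w x)%:E)%E.
  by apply: integral_ge0 => x _; rewrite lee_fin mulr_ge0 ?sqr_ge0.
have -> : (\int[mu]_x ((g x - c) ^+ 2 * w x)%:E = (J - 2 * c * I + c ^+ 2 * t)%:E)%E.
  transitivity (\int[mu]_x ((g x ^+ 2 * w x)%:E + ((- (2 * c))%:E * (g x * w x)%:E + (c ^+ 2)%:E * (w x)%:E)))%E.
    by apply: eq_integral => x _; rewrite -!EFinM -!EFinD; congr (_%:E); ring.
  rewrite integralD//; last by apply: integrableD => //; exact: integrableZl.
  rewrite integralD//; [|exact: integrableZl|exact: integrableZl].
  rewrite !integralZl// hI hJ wt -!EFinM -!EFinD; congr (_%:E); ring.
rewrite hJ -EFinM !lee_fin => h.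
have hc : I = c * t by rewrite /c mulrAC mulVf ?mul1r// gt_eqF.
rewrite hc in h.
rewrite ler_pdivlMl//; nra.
Qed.

(** The quadratic inequality is used twice, for [g] and for its square. *)
Lemma jensen_pow4 d (T : measurableType d) (R : realType) (mu : {measure set T -> \bar R})
    (w g : T -> R) (t : R) : 0 < t -> measurable_fun setT w -> measurable_fun setT g ->
  (forall x, w x = 0 \/ w x = 1) -> (\int[mu]_x (w x)%:E = t%:E)%E ->
  mu.-integrable setT (fun x => (g x * w x)%:E) ->
  (((t^-1 * fine (\int[mu]_x (g x * w x)%:E)) ^+ 4)%:E <=
    t^-1%:E * \int[mu]_x (g x ^+ 4 * w x)%:E)%E.
Proof.
move=> t0 mw mg w01 wt ig.
have w0 x : 0 <= w x by case: (w01 x) => ->.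
have m2 : measurable_fun setT (fun x => g x ^+ 2) by exact: measurable_funX.
have m4 : measurable_fun setT (fun x => (g x ^+ 4 * w x)%:E).
  by apply/measurable_EFinP; apply: measurable_funM => //; exact: measurable_funX.
have p4 x : (0 <= (g x ^+ 4 * w x)%:E)%E by rewrite lee_fin mulr_ge0 // exprn_even_ge0.
have [Joo|Jfin] := eqVneq (\int[mu]_x (g x ^+ 4 * w x)%:E)%E +oo%E.
  by rewrite Joo gt0_muley ?leey// lte_fin invr_gt0.
have i4 : mu.-integrable setT (fun x => (g x ^+ 4 * w x)%:E).
  apply/integrableP; split => //.
  by under eq_integral do rewrite gee0_abs//; rewrite ltey.
have iw : mu.-integrable setT (fun x => (w x)%:E).
  apply/integrableP; split; first exact/measurable_EFinP.
  by under eq_integral do rewrite gee0_abs ?lee_fin//; rewrite wt ltry.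
have i2 : mu.-integrable setT (fun x => (g x ^+ 2 * w x)%:E).
  apply: le_integrable (integrableD measurableT i4 iw) => //.
    by apply/measurable_EFinP; exact: measurable_funM.
  move=> x _; rewrite -EFinD /= lee_fin ger0_norm; last by apply: mulr_ge0 => //; exact: sqr_ge0.
  rewrite ger0_norm; last by apply: addr_ge0 => //; have := p4 x; rewrite lee_fin.
  (* The bound g^2 <= g^4 + 1 suffices because the weight has finite mass. *)
  rewrite -[X in _ + X]mul1r -mulrDl ler_wpM2r//.
  rewrite (_ : 4 = 2 * 2)%N// exprM; nra.
have h1 := jensen_sq t0 mw mg w01 wt ig.
have h2 := jensen_sq t0 mw m2 w01 wt i2.
have e4 (x : R) : x ^+ 4 = (x ^+ 2) ^+ 2 by rewrite -exprM.
have -> : (\int[mu]_x (g x ^+ 4 * w x)%:E = \int[mu]_x ((g x ^+ 2) ^+ 2 * w x)%:E)%E.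
  by apply: eq_integral => x _; rewrite e4.
apply: le_trans h2; move: h1.
rewrite -[X in (_ <= _ * X)%E](fineK (integrable_fin_num measurableT i2)) -EFinM !lee_fin => h1.
by rewrite e4 lerXn2r ?nnegrE ?sqr_ge0// (le_trans _ h1)// sqr_ge0.
Qed.

(** * Powers and limits of window averages *)

Section WindowIntegrals.
Context {R : realType}.
Notation leb := (@lebesgue_measure R).
Notation mu2 := (leb \x leb)%E.
Notation locint := (@locally_integrable R setT).
Implicit Types (f g c K u v : R -> R).

Lemma integral_indic_window (t x : R) : 0 <= t ->
  (\int[leb]_s (\1_(`[0%R, t[%classic) (s - x)%R : R)%:E = t%:E)%E.
Proof.
move=> t0.
rewrite (_ : (fun s : R => _) = (fun s : R => (\1_(`[x, (x + t)%R[%classic) s)%:E)); last first.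
  apply/funext => s; rewrite !indicE; congr ((_ _)%:R%:E).
  by apply/idP/idP; rewrite !inE/= !in_itv/= => /andP[h1 h2]; apply/andP; split; lra.
rewrite integral_indic//= setIT lebesgue_measure_itv/= lte_fin ltrDl.
by case: ltP => h; rewrite ?EFinD -?EFinB ?[x + t]addrC ?addrK//; congr (_%:E); lra.
Qed.

Lemma integral_indic_window' (t s : R) : 0 <= t ->
  (\int[leb]_x (\1_(`[0%R, t[%classic) (s - x)%R : R)%:E = t%:E)%E.
Proof.
move=> t0.
rewrite (_ : (fun x : R => _) = (fun x : R => (\1_(`](s - t)%R, s]%classic) x)%:E)); last first.
  apply/funext => x; rewrite !indicE; congr ((_ _)%:R%:E).
  by apply/idP/idP; rewrite !inE/= !in_itv/= => /andP[h1 h2]; apply/andP; split; lra.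
rewrite integral_indic//= setIT lebesgue_measure_itv/= lte_fin.
by case: ltP => h; rewrite -?EFinB; congr (_%:E); lra.
Qed.

Lemma integral_window_tonelli g (t : R) : measurable_fun setT g -> (forall x, 0 <= g x) ->
  0 <= t ->
  (\int[leb]_x \int[leb]_s (g s * (\1_(`[0%R, t[%classic) (s - x)%R : R))%:E =
   t%:E * \int[leb]_s (g s)%:E)%E.
Proof.
move=> mg g0 t0.
have mh : measurable_fun [set: R * R]
    (fun z : R * R => (g z.2 * (\1_(`[0, t[%classic) (z.2 - z.1) : R))%:E).
  apply/measurable_EFinP; apply: measurable_funM; last exact: measurable_window.
  exact: (measurableT_comp mg (@measurable_snd _ _ _ _)).
have := @fubini_tonelli _ _ _ _ _ leb leb _ mh.
rewrite /fubini_F /fubini_G /= => ->; last by move=> z; rewrite lee_fin mulr_ge0// indicE.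
rewrite -ge0_integralZl//; last 2 first.
- exact/measurable_EFinP.
- by move=> x _; rewrite lee_fin.
apply: eq_integral => s _.
under eq_integral do rewrite EFinM.
rewrite ge0_integralZl//.
- by rewrite integral_indic_window'// muleC.
- apply/measurable_EFinP.
  apply: (@measurableT_comp _ _ _ _ _ _ (\1_(`[0, t[%classic) : R -> R)).
    exact: measurable_indic.
  exact: measurable_funB.
- by rewrite lee_fin.
Qed.

(** Jensen bounds the power of the average by the average of the power; by Tonelli each point s then
    counts with the measure [t] of the windows that contain it. *)
Lemma window_int_pow_le g (t : R) k : k = 2%N \/ k = 4%N -> locint g -> 0 < t ->
  (\int[leb]_x ((t^-1 * window_int g t x) ^+ k)%:E <= \int[leb]_x (g x ^+ k)%:E)%E.
Proof.
move=> k24 lg t0; have mg := locint_measurable lg.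
have k0 (x : R) : 0 <= x ^+ k by apply: exprn_even_ge0; case: k24 => ->.
have mG := locint_measurable (window_int_locint lg (ltW t0)).
have -> : (\int[leb]_x (g x ^+ k)%:E = t^-1%:E * (t%:E * \int[leb]_x (g x ^+ k)%:E))%E.
  by rewrite muleA -EFinM mulVf ?mul1e// gt_eqF.
rewrite -integral_window_tonelli//; [|exact: measurable_funX|exact: ltW].
have m2 : measurable_fun [set: R] (fun x : R => \int[leb]_s
   (g s ^+ k * (\1_(`[0%R, t[%classic) (s - x)%R : R))%:E)%E.
  apply: (@measurable_section_integral _ (fun z : R * R =>
    (g z.2 ^+ k * (\1_(`[0%R, t[%classic) (z.2 - z.1)%R : R))%:E)).
  apply/measurable_EFinP; apply: measurable_funM; last exact: measurable_window.
  by apply: measurable_funX; exact: (measurableT_comp mg (@measurable_snd _ _ _ _)).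
rewrite -ge0_integralZl//; last 2 first.
- by move=> x _; apply: integral_ge0 => s _; rewrite lee_fin mulr_ge0// indicE.
- by rewrite lee_fin invr_ge0 ltW.
apply: ge0_le_integral => //.
- by move=> x _; rewrite lee_fin.
- by apply/measurable_EFinP; apply: measurable_funX; exact: measurable_funM.
- exact: measurable_funeM.
- move=> x _.
  have -> : window_int g t x = fine (\int[leb]_s (g s * (\1_(`[0, t[%classic) (s - x)%R : R))%:E)%E.
    by rewrite -window_intE// ltW.
  have mw : measurable_fun [set: R] (fun s : R => \1_(`[0, t[%classic) (s - x)%R : R).
    apply: (@measurableT_comp _ _ _ _ _ _ (\1_(`[0, t[%classic) : R -> R)).
      exact: measurable_indic.
    exact: measurable_funB.
  have w01 s : (\1_(`[0, t[%classic) (s - x)%R : R) = 0 \/ (\1_(`[0, t[%classic) (s - x)%R : R) = 1.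
    by rewrite indicE; case: (_ \in _); [right|left].
  have wt := integral_indic_window x (ltW t0).
  have iw := window_section_integrable x lg (ltW t0).
  by case: k24 => ->; [exact: jensen_sq iw|exact: jensen_pow4 iw].
Qed.

(** The window starts at [x] for [o] = 0 and ends there for [o] = 1, which covers forward and
    backward quotients; both families shrink nicely. *)
Lemma window_int_cvg_at g (o : R) x : locint g -> o = 0 \/ o = 1 -> lebesgue_pt g x ->
  n.+1%:R * window_int g n.+1%:R^-1 (x - o * n.+1%:R^-1) @[n --> \oo] --> g x.
Proof.
move=> lg o01 hx.
pose E (x : R) (n : nat) : set R := `[x - o * n.+1%:R^-1, x - o * n.+1%:R^-1 + n.+1%:R^-1[%classic.
have hE y n : leb (E y n) = (n.+1%:R^-1)%:E.
  rewrite /E lebesgue_measure_itv/= lte_fin ltrDl invr_gt0 ltr0n /=.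
  by rewrite -EFinB; congr (_%:E); ring.
have nice y : nicely_shrinking y (E y).
  split; first by move=> n; exact: measurable_itv.
  (* Twice the window length is the radius, so that the open ball contains the closed window; its
     measure is then 4 times that of the window. *)
  exists (4, fun n => (2 * n.+1%:R^-1)%:pos); split => //=.
  - rewrite -[X in _ --> X](mulr0 2).
    by apply: cvgM; [exact: cvg_cst|exact: cvg_harmonic].
  - move=> n z; have n0 : 0 < n.+1%:R^-1 :> R by rewrite invr_gt0.
    rewrite /E /ball /= in_itv/= ltr_norml.
    by move: n.+1%:R^-1 n0 => r r0 /andP[h1 h2]; case: o01 h1 h2 => -> h1 h2; apply/andP; split; lra.
  - move=> n; rewrite hE lebesgue_measure_ball// -EFinM lee_fin mulr2n.
    have n0 : 0 < n.+1%:R^-1 :> R by rewrite invr_gt0.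
    by move: n.+1%:R^-1 n0 => r r0; lra.
have := nice_lebesgue_differentiation nice lg hx.
move=> /fine_cvgP[_]; apply: cvg_trans; apply: near_eq_cvg; apply: nearW => n /=.
rewrite hE inver gt_eqF ?invr_gt0 ?ltr0n// invrK fineM//=.
apply: integrable_fin_num => //; first exact: measurable_itv.
rewrite /E; apply: integrableS (locint_itv (x - o * n.+1%:R^-1) (x - o * n.+1%:R^-1 + n.+1%:R^-1) lg) => //.
by move=> y /=; rewrite !in_itv/= => /andP[-> /ltW].
Qed.

End WindowIntegrals.

Lemma norm_mul_le_sqr (R : realType) (a b : R) : `|a * b| <= a ^+ 2 + b ^+ 2.
Proof.
rewrite normrM -(real_normK (num_real a)) -(real_normK (num_real b)).
by have := sqr_ge0 (`|a| - `|b|); have := normr_ge0 a; have := normr_ge0 b; nra.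
Qed.

(** * Slicing the plane *)

Section Slices.
Context {R : realType}.
Notation leb := (@lebesgue_measure R).
Notation mu2 := (leb \x leb)%E.
Notation locint := (@locally_integrable R setT).
Implicit Types (f g h : R * R -> R).

(** Local integrability on the plane, phrased through bounded functions supported in a square so
    that it applies directly to cut-offs and tensor products. *)
Definition loc2 f := measurable_fun setT f /\
  forall (phi : R * R -> R) (M B : R), measurable_fun setT phi ->
    (forall z, `|phi z| <= B) ->
    (forall z, M < `|z.1| \/ M < `|z.2| -> phi z = 0) ->
    mu2.-integrable setT (fun z => (f z * phi z)%:E).

Lemma measurable_fst_comp (u : R -> R) : measurable_fun setT u ->
  measurable_fun [set: R * R] (fun z : R * R => u z.1).
Proof. by move=> mu_; exact: (measurableT_comp mu_ (@measurable_fst _ _ _ _)). Qed.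

Lemma measurable_snd_comp (u : R -> R) : measurable_fun setT u ->
  measurable_fun [set: R * R] (fun z : R * R => u z.2).
Proof. by move=> mu_; exact: (measurableT_comp mu_ (@measurable_snd _ _ _ _)). Qed.

Lemma measurable_slice f (x : R) : measurable_fun setT f ->
  measurable_fun [set: R] (fun y : R => f (x, y)).
Proof. by move=> mf; apply: (measurableT_comp mf); exact: measurable_fun_pair. Qed.

Lemma loc2_tensor f (u v : R -> R) (M B C : R) : loc2 f ->
  measurable_fun setT u -> measurable_fun setT v ->
  (forall x, `|u x| <= B) -> (forall x, `|v x| <= C) ->
  (forall x, M < `|x| -> u x = 0) -> (forall x, M < `|x| -> v x = 0) ->
  mu2.-integrable setT (fun z => (f z * (u z.1 * v z.2))%:E).
Proof.
move=> [mf lf] mu_ mv uB vC uM vM.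
apply: (lf (fun z => u z.1 * v z.2) M (B * C)).
- by apply: measurable_funM; [exact: measurable_fst_comp|exact: measurable_snd_comp].
- by move=> z; rewrite normrM ler_pM.
- by move=> z [/uM ->|/vM ->]; rewrite ?mul0r ?mulr0.
Qed.

Lemma loc2_bounded f : measurable_fun setT f -> (forall z, `|f z| <= 1) -> loc2 f.
Proof.
move=> mf f1; split => // phi M B mphi phiB phiM.
have B0 : 0 <= B by apply: le_trans (phiB (0, 0)).
have ib := integrable_tensor (integrable_cut M) (integrable_cut M).
apply: le_integrable (integrableZl measurableT B ib) => //.
  by apply/measurable_EFinP; exact: measurable_funM.
move=> z _; rewrite -EFinM /= lee_fin normrM.
have [h1|h1] := leP `|z.1| M; last by rewrite phiM ?normr0 ?mulr0//; left.
have [h2|h2] := leP `|z.2| M; last by rewrite phiM ?normr0 ?mulr0//; right.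
by rewrite !cut_in// !mulr1 (ger0_norm B0) -[leRHS]mul1r ler_pM.
Qed.

Lemma loc2_L2 f : L2 f -> loc2 f.
Proof.
move=> [mf]; rewrite /leb2 => f2; split => // phi M B mphi phiB phiM.
have ib := integrable_tensor (integrable_cut M) (integrable_cut M).
have i2 : mu2.-integrable setT (fun z : R * R => (f z ^+ 2)%:E).
  apply/integrableP; split; first by apply/measurable_EFinP; exact: measurable_funX.
  by under eq_integral do rewrite gee0_abs ?lee_fin ?sqr_ge0//.
apply: le_integrable (integrableD measurableT i2 (integrableZl measurableT (B ^+ 2) ib)) => //.
  by apply/measurable_EFinP; exact: measurable_funM.
move=> z _; rewrite -EFinM -EFinD /= lee_fin.
rewrite [leRHS]ger0_norm; last by rewrite addr_ge0 ?sqr_ge0// mulr_ge0 ?sqr_ge0// mulr_ge0// cut_ge0.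
apply: (le_trans (norm_mul_le_sqr _ _)); rewrite lerD2l.
have [h1|h1] := leP `|z.1| M; last first.
  rewrite phiM; last by left.
  by rewrite expr0n /= mulr_ge0 ?sqr_ge0// mulr_ge0// cut_ge0.
have [h2|h2] := leP `|z.2| M; last first.
  rewrite phiM; last by right.
  by rewrite expr0n /= mulr_ge0 ?sqr_ge0// mulr_ge0// cut_ge0.
rewrite !cut_in// !mulr1 -(real_normK (num_real (phi z))).
by rewrite lerXn2r// nnegrE// (le_trans _ (phiB z)).
Qed.

(** The measure of the exceptional set is the integral of the measures of its sections. *)
Lemma ae_slices (P : R * R -> Prop) : measurable [set z | P z] ->
  {ae leb, forall x, {ae leb, forall y, P (x, y)}} -> {ae mu2, forall z, P z}.
Proof.
move=> mP h; exists (~` [set z | P z]); split => //; first exact: measurableC.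
rewrite /product_measure1 -[RHS](integral0 leb setT); apply: ae_eq_integral => //.
  by apply: measurable_fun_xsection; exact: measurableC.
apply: (@filterS _ _ (ae_filter_ringOfSetsType leb) _ _ _ h) => x hx _.
have -> : (leb \o xsection (~` [set z | P z])) x = leb (~` [set y | P (x, y)]).
  by rewrite /=; congr (leb _); apply/seteqP; split => y; rewrite /xsection/= inE.
have [N [mN N0 hN]] := hx.
apply/eqP; rewrite eq_le measure_ge0 andbT -N0; apply: le_measure => //; rewrite inE.
  rewrite (_ : ~` _ = (fun y => (x, y)) @^-1` (~` [set z | P z]))//.
  rewrite -[X in measurable X]setTI.
  exact: (measurable_fun_pair (measurable_cst x) (@measurable_id _ _ setT) measurableT (measurableC mP)).
exact: mN.
Qed.

Lemma integrable_fine (Phi : R -> \bar R) : leb.-integrable setT Phi ->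
  leb.-integrable setT (fun x : R => (fine (Phi x))%:E).
Proof.
move=> iP; apply: le_integrable (iP) => //.
  apply/measurable_EFinP; apply: measurableT_comp => //; exact: (measurable_int _ iP).
by move=> x _; case: (Phi x) => [r||] //=; rewrite normr0 leey.
Qed.

(** The slice integral is a locally integrable function of [x] whose integrals against all rational
    plateaus vanish. *)
Lemma slice_integral_eq0 h : measurable_fun setT h ->
  (forall M, mu2.-integrable setT (fun z => (h z * cut M z.1)%:E)) ->
  (forall (p q : rat) m, \int[mu2]_z (h z * plateau (ratr p) (ratr q) m z.1)%:E = 0)%E ->
  {ae leb, forall x, (\int[leb]_y (h (x, y))%:E = 0)%E}.
Proof.
move=> mh ih h0.
have inth : {ae leb, forall x, leb.-integrable setT (fun y : R => (h (x, y))%:E)}.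
  have : {ae leb, forall x, forall n : nat,
      leb.-integrable setT (fun y : R => (h (x, y) * cut n%:R x)%:E)}.
    by apply: ae_foralln => n; exact: (ae_integrable1 (ih n%:R)).
  apply: (@filterS _ _ (ae_filter_ringOfSetsType leb)) => x /(_ (Num.truncn `|x|).+1).
  by rewrite cut_in ?ltW ?truncnS_gt//; under eq_fun do rewrite mulr1.
(* The default value 0 of [fine] can only intervene on the null set of slices that are not
   integrable. *)
pose K x : R := fine (\int[leb]_y (h (x, y))%:E)%E.
have mhE : measurable_fun setT (fun z => (h z)%:E) by exact/measurable_EFinP.
have lK : locint K.
  apply: locintP.
    apply: measurableT_comp => //; exact: (measurable_section_integral mhE).
  move=> M; have := integrable_fine (integrable_fubini_F (ih M)).
  apply: eq_integrable => // x _; rewrite /fubini_F /= /K; congr (_%:E).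
  have [hx|hx] := leP `|x| M.
    by rewrite cut_in// mulr1; under eq_integral do rewrite mulr1.
  by rewrite cut_out// mulr0; under eq_integral do rewrite mulr0; rewrite integral0.
have K0 : {ae leb, forall x, K x = 0}.
  apply: locint_ae_eq0 => // p q m; rewrite -(h0 p q m).
  set a := plateau (ratr p) (ratr q) m; pose M : R := Num.max `|ratr p| `|ratr q|.
  have ia : mu2.-integrable setT (fun z => (h z * a z.1)%:E).
    apply: le_integrable (ih M) => //.
      apply/measurable_EFinP; apply: measurable_funM => //.
      by apply: measurable_fst_comp; exact: measurable_plateau.
    move=> z _ /=; rewrite lee_fin normrM [in leRHS]normrM ler_wpM2l//.
    have [hx|hx] := leP `|z.1| M; first by rewrite cut_in// normr1 plateau_norm_le1.
    by rewrite /a plateau_supp// normr0.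
  rewrite -(integral12_prod_meas1 ia); apply: ae_eq_integral => //.
  - apply/measurable_EFinP; apply: measurable_funM; first by case: lK.
    exact: measurable_plateau.
  - exact: (measurable_int _ (integrable_fubini_F ia)).
  - apply: (@filterS _ _ (ae_filter_ringOfSetsType leb) _ _ _ inth) => x ix _.
    rewrite /fubini_F /=.
    under [RHS]eq_integral do rewrite mulrC EFinM.
    rewrite integralZl// EFinM muleC; congr (_ * _)%E.
    by rewrite /K fineK//; exact: (integrable_fin_num measurableT ix).
apply: (@filterS2 _ _ (ae_filter_ringOfSetsType leb) _ _ _ _ inth K0) => x ix Kx.
by rewrite -(fineK (integrable_fin_num measurableT ix)) -/(K x) Kx.
Qed.

End Slices.

(** * Weak derivatives on almost every line *)

Section WeakSlices.
Context {R : realType}.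
Notation leb := (@lebesgue_measure R).
Notation mu2 := (leb \x leb)%E.
Notation locint := (@locally_integrable R setT).
Implicit Types (f g h : R * R -> R).

Lemma loc2_slices f : loc2 f -> {ae leb, forall x, locint (fun y => f (x, y))}.
Proof.
move=> lf; have [mf _] := lf.
have : {ae leb, forall x, forall n : nat,
    leb.-integrable setT (fun y : R => (f (x, y) * (cut n%:R x * cut n%:R y))%:E)}.
  apply: ae_foralln => n.
  exact: (ae_integrable1 (loc2_tensor lf (measurable_cut n%:R) (measurable_cut n%:R)
    (cut_le1 n%:R) (cut_le1 n%:R) (@cut_out _ n%:R) (@cut_out _ n%:R))).
apply: (@filterS _ _ (ae_filter_ringOfSetsType leb)) => x hx.
apply: locintP; first exact: measurable_slice.
move=> M; pose n := (Num.truncn (`|x| + `|M|)).+1.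
have hn : `|x| + `|M| < n%:R by exact: truncnS_gt.
have xn : `|x| <= n%:R by have := normr_ge0 M; lra.
apply: le_integrable (hx n) => //.
  by apply/measurable_EFinP; apply: measurable_funM; [exact: measurable_slice|exact: measurable_cut].
move=> y _ /=; rewrite lee_fin normrM [leRHS]normrM ler_wpM2l// (cut_in xn) mul1r.
have [hy|hy] := leP `|y| M; last by rewrite cut_out// normr0.
by rewrite !cut_in//; have := ler_norm M; have := normr_ge0 x; lra.
Qed.

(* Weak derivative in the second variable tested on tensor products only: this form, unlike
   [weak_pd], is transported by swapping the coordinates. *)
Definition weakT2 f g := forall (u v v' : R -> R) (M : R), smooth1 u -> smooth1 v ->
  (forall t, M < `|t| -> u t = 0) -> (forall t, M < `|t| -> v t = 0) ->
  (forall t : R, is_derive t 1 v (v' t)) ->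
  (\int[mu2]_z (f z * (u z.1 * v' z.2))%:E = - \int[mu2]_z (g z * (u z.1 * v z.2))%:E)%E.

(** A plateau in [x] times [plateau_win] in [y] is an admissible test function. Varying the first
    factor isolates almost every slice; as the second factor and the step run through a countable
    family, a single null set of slices is discarded. *)
Lemma weak_slices f g : loc2 f -> loc2 g -> weakT2 f g ->
  {ae leb, forall x, [/\ locint (fun y => f (x, y)), locint (fun y => g (x, y)) &
    forall n : nat, {ae leb, forall y, f (x, y + n.+1%:R^-1) - f (x, y) =
      window_int (fun y => g (x, y)) n.+1%:R^-1 y}]}.
Proof.
move=> lf lg wfg; have [mf _] := lf; have [mg _] := lg.
have H : {ae leb, forall x, forall i : rat * rat * nat * nat,
  let: (p, q, m, n) := i in
  (\int[leb]_y (f (x, y) * (plateau (ratr p) (ratr q) m y -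
     plateau (ratr p) (ratr q) m (y - n.+1%:R^-1)%R) +
     g (x, y) * plateau_win (ratr p) (ratr q) n.+1%:R^-1 m y)%:E = 0)%E}.
  apply: ae_countable => -[[[p q] m] n].
  set t : R := n.+1%:R^-1.
  have t0 : 0 <= t by rewrite invr_ge0.
  pose A := plateau_win (ratr p) (ratr q) t m.
  pose A' (y : R) := plateau (ratr p) (ratr q) m y - plateau (ratr p) (ratr q) m (y - t).
  pose M : R := Num.max `|ratr p| `|ratr q| + t.
  have mA : measurable_fun setT A.
    by apply: continuous_measurable_fun; apply: smooth1_continuous; exact: plateau_win_smooth.
  have mA' : measurable_fun setT A'.
    apply: measurable_funB; first exact: measurable_plateau.
    by apply: (measurableT_comp (measurable_plateau _ _ _)); exact: measurable_funB.
  have [B AB] := plateau_win_bounded (ratr p) (ratr q) m t0.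
  have AM y : M < `|y| -> A y = 0 by move=> hy; exact: plateau_win_out.
  have A'B y : `|A' y| <= 2.
    apply: (le_trans (ler_normB _ _)).
    by rewrite (_ : 2 = 1 + 1 :> R)// lerD ?plateau_norm_le1.
  have A'M y : M < `|y| -> A' y = 0.
    move=> hy; rewrite /A' !plateau_supp ?subrr//; last by rewrite /M in hy; lra.
    have : `|y| <= `|y - t| + `|t| by rewrite -{1}(subrK t y) ler_normD.
    by rewrite (ger0_norm t0) /M in hy * => h3; lra.
  pose h z := f z * A' z.2 + g z * A z.2.
  have ih (u : R -> R) (N : R) : measurable_fun setT u -> (forall x, `|u x| <= 1) ->
      (forall x, N < `|x| -> u x = 0) ->
      mu2.-integrable setT (fun z => (f z * (u z.1 * A' z.2))%:E) /\
      mu2.-integrable setT (fun z => (g z * (u z.1 * A z.2))%:E).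
    move=> mu_ u1 uN.
    have uN' x : Num.max N M < `|x| -> u x = 0.
      by rewrite gt_max => /andP[h1 _]; exact: uN.
    split.
      apply: (loc2_tensor lf mu_ mA' u1 A'B uN') => y; rewrite gt_max => /andP[_]; exact: A'M.
    apply: (loc2_tensor lg mu_ mA u1 AB uN') => y; rewrite gt_max => /andP[_]; exact: AM.
  apply: (@slice_integral_eq0 _ h).
  - apply: measurable_funD; apply: measurable_funM => //; exact: measurable_snd_comp.
  - move=> N; have [i1 i2] := ih _ N (measurable_cut N) (cut_le1 N) (@cut_out _ N).
    apply: eq_integrable (integrableD measurableT i1 i2) => // z _.
    by rewrite /= -EFinD /h; congr (_%:E); ring.
  - move=> p' q' m'.
    pose N : R := Num.max `|ratr p'| `|ratr q'|.
    pose a : R -> R := plateau (ratr p') (ratr q') m'.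
    have [i1 i2] := ih a N (measurable_plateau _ _ _) (plateau_norm_le1 _ _ _)
      (fun x => @plateau_supp _ _ _ _ x).
    have e : (\int[mu2]_z (f z * (a z.1 * A' z.2))%:E =
        - \int[mu2]_z (g z * (a z.1 * A z.2))%:E)%E.
      apply: (wfg _ _ _ (Num.max N M)).
      + exact: plateau_smooth.
      + exact: plateau_win_smooth.
      + by move=> x; rewrite gt_max => /andP[h1 _]; exact: plateau_supp.
      + by move=> x; rewrite gt_max => /andP[_ h1]; exact: AM.
      + exact: plateau_win_derive.
    transitivity (\int[mu2]_z ((f z * (a z.1 * A' z.2))%:E + (g z * (a z.1 * A z.2))%:E))%E.
      by apply: eq_integral => z _; rewrite -EFinD /h; congr (_%:E); rewrite /a; ring.
    rewrite integralD// e.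
    have fi := integrable_fin_num measurableT i2.
    by rewrite addeC subee.
apply: (@filterS3 _ _ (ae_filter_ringOfSetsType leb) _ _ _ _ _ H (loc2_slices lf) (loc2_slices lg)).
move=> x hx lfx lgx; split => // n.
apply: (@translation_identity _ (fun y => f (x, y)) (fun y => g (x, y)) n.+1%:R^-1) => //.
move=> p q m; have := hx (p, q, m, n) => /=.
set t : R := n.+1%:R^-1.
have t0 : 0 <= t by rewrite invr_ge0.
have [B AB] := plateau_win_bounded (ratr p) (ratr q) m t0.
pose M : R := Num.max `|ratr p| `|ratr q| + t.
have i1 : leb.-integrable setT (fun y : R => (f (x, y) * (plateau (ratr p) (ratr q) m y -
     plateau (ratr p) (ratr q) m (y - t)%R))%:E).
  apply: (@locint_mul _ _ _ M 2 lfx).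
  - apply: measurable_funB; first exact: measurable_plateau.
    by apply: (measurableT_comp (measurable_plateau _ _ _)); exact: measurable_funB.
  - move=> y; apply: (le_trans (ler_normB _ _)).
    by rewrite (_ : 2 = 1 + 1 :> R)// lerD ?plateau_norm_le1.
  - move=> y hy; rewrite !plateau_supp ?subrr//; last by rewrite /M in hy; lra.
    have : `|y| <= `|y - t| + `|t| by rewrite -{1}(subrK t y) ler_normD.
    by rewrite (ger0_norm t0) /M in hy * => h3; lra.
have i2 : leb.-integrable setT (fun y : R => (g (x, y) * plateau_win (ratr p) (ratr q) t m y)%:E).
  apply: (@locint_mul _ _ _ M B lgx) => //.
    by apply: continuous_measurable_fun; apply: smooth1_continuous; exact: plateau_win_smooth.
  by move=> y hy; exact: plateau_win_out.
under eq_integral do rewrite EFinD.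
rewrite integralD//.
have E (X Y : \bar R) : Y \is a fin_num -> (X + Y = 0 -> X = - Y)%E.
  by move: X Y => [X||] [Y||]//= _ [] /eqP; rewrite addr_eq0 => /eqP ->.
by apply: E; exact: (integrable_fin_num measurableT i2).
Qed.

End WeakSlices.

(** * Difference quotients and weak derivatives *)

Section DifferenceQuotients.
Context {R : realType}.
Notation leb := (@lebesgue_measure R).
Notation mu2 := (leb \x leb)%E.
Notation locint := (@locally_integrable R setT).
Implicit Types (f g h : R * R -> R) (j : 'I_2).

Definition dq j (t : R) f (z : R * R) : R := t^-1 * (f (sh j t z) - f z).

Lemma measurable_sh j t : measurable_fun [set: R * R] (sh j t : R * R -> R * R).
Proof. by have [] := sh_mpres j t. Qed.

Lemma measurable_fun_sh j t f : measurable_fun setT f ->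
  measurable_fun [set: R * R] (fun z => f (sh j t z)).
Proof. by move=> mf; apply: (measurableT_comp mf); exact: measurable_sh. Qed.

Lemma measurable_dq j t f : measurable_fun setT f -> measurable_fun [set: R * R] (dq j t f).
Proof.
move=> mf; apply: measurable_funM => //; apply: measurable_funB => //.
exact: measurable_fun_sh.
Qed.

(** To obtain a measurable property, convergence is encoded as the vanishing of the upper limit [L]
    of the distances. *)
Lemma ae_slices_cvg (f_ : nat -> R * R -> R) f :
  (forall n, measurable_fun setT (f_ n)) -> measurable_fun setT f ->
  {ae leb, forall x, {ae leb, forall y, f_ n (x, y) @[n --> \oo] --> f (x, y)}} ->
  {ae mu2, forall z, f_ n z @[n --> \oo] --> f z}.
Proof.
move=> mf_ mf h.
pose L z : \bar R := limn_esup (fun n => `|f_ n z - f z|%:E).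
have mL : measurable_fun setT L.
  apply: measurable_fun_limn_esup => n; apply/measurable_EFinP; apply: measurableT_comp => //.
  exact: measurable_funB.
have LP z : L z = 0%E <-> f_ n z @[n --> \oo] --> f z.
  split => [hz|hz]; last first.
    have : `|f_ n z - f z|%:E @[n --> \oo] --> 0%E.
      apply: cvg_EFin; first exact: nearW.
      rewrite -[X in _ --> X](@normr0 R R); apply: cvg_norm.
      by rewrite -(subrr (f z)); apply: cvgB => //; exact: cvg_cst.
    by move=> /cvg_limn_einf_sup[_].
  have : `|f_ n z - f z|%:E @[n --> \oo] --> 0%E.
    by apply: limn_esup_le_cvg; [rewrite -/(L z) hz|move=> n; rewrite lee_fin].
  move=> /fine_cvgP[_] /= /norm_cvg0P.
  move=> h0.
  have : f_ n z - f z + f z @[n --> \oo] --> 0 + f z by apply: cvgD => //; exact: cvg_cst.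
  rewrite add0r.
  by apply: cvg_trans; apply: near_eq_cvg; apply: nearW => n /=; rewrite subrK.
have : {ae mu2, forall z, L z = 0%E}.
  apply: ae_slices.
    rewrite (_ : [set z | _] = setT `&` (L @^-1` [set 0%E])); last by rewrite setTI.
    exact: mL.
  apply: (@filterS _ _ (ae_filter_ringOfSetsType leb) _ _ _ h) => x.
  by apply: (@filterS _ _ (ae_filter_ringOfSetsType leb)) => y /LP.
by apply: (@filterS _ _ (ae_filter_ringOfSetsType mu2)) => z /LP.
Qed.

Lemma dq_cvg2 f g (o : bool) : loc2 f -> loc2 g -> weakT2 f g ->
  {ae mu2, forall z, dq ord_max ((-1) ^+ o * n.+1%:R^-1) f z @[n --> \oo] --> g z}.
Proof.
move=> lf lg w; have [mf _] := lf; have [mg _] := lg.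
apply: ae_slices_cvg => //; first by move=> n; exact: measurable_dq.
apply: (@filterS _ _ (ae_filter_ringOfSetsType leb) _ _ _ (weak_slices lf lg w)).
move=> x [lfx lgx /ae_foralln hx].
(* Backward increments are forward ones at a translated point, and translation preserves null
   sets. *)
have hx' : {ae leb, forall y n, f (x, y) - f (x, y - n.+1%:R^-1) =
    window_int (fun y => g (x, y)) n.+1%:R^-1 (y - n.+1%:R^-1)}.
  apply: ae_foralln => n.
  have h : {ae leb, forall y, f (x, y + n.+1%:R^-1) - f (x, y) =
      window_int (fun y => g (x, y)) n.+1%:R^-1 y}.
    by apply: (@filterS _ _ (ae_filter_ringOfSetsType leb) _ _ _ hx) => y.
  have := mpres_ae (shR_mpres (- n.+1%:R^-1)) h.
  apply: (@filterS _ _ (ae_filter_ringOfSetsType leb)) => y.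
  by rewrite /shR subrK.
have hleb := lebesgue_differentiation lgx.
apply: (@filterS3 _ _ (ae_filter_ringOfSetsType leb) _ _ _ _ _ hx hx' hleb).
move=> y h1 h2 h3; case: o => /=.
  have := window_int_cvg_at lgx (or_intror erefl) h3.
  apply: cvg_trans; apply: near_eq_cvg; apply: nearW => n /=.
  rewrite /dq /sh /= expr1 mulN1r mul1r -h2 invrN invrK.
  by rewrite mulNr -mulrN opprB.
have := window_int_cvg_at lgx (or_introl erefl) h3.
apply: cvg_trans; apply: near_eq_cvg; apply: nearW => n /=.
by rewrite /dq /sh /= expr0 mul1r mul0r subr0 -h1 invrK.
Qed.

(** On almost every line the quotient is a window average; the bound on the line is then integrated
    in the other variable. *)
Lemma dq_pow_le2 f g k n : k = 2%N \/ k = 4%N -> loc2 f -> loc2 g -> weakT2 f g ->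
  (\int[mu2]_z (dq ord_max n.+1%:R^-1 f z ^+ k)%:E <= \int[mu2]_z (g z ^+ k)%:E)%E.
Proof.
move=> k24 lf lg w; have [mf _] := lf; have [mg _] := lg.
have k0 (x : R) : 0 <= x ^+ k by apply: exprn_even_ge0; case: k24 => ->.
have m1 : measurable_fun [set: R * R] (fun z => (dq ord_max n.+1%:R^-1 f z ^+ k)%:E).
  by apply/measurable_EFinP; apply: measurable_funX; exact: measurable_dq.
have m2 : measurable_fun [set: R * R] (fun z => (g z ^+ k)%:E).
  by apply/measurable_EFinP; apply: measurable_funX.
rewrite !fubini_tonelli1//; [|by move=> z; rewrite lee_fin..].
rewrite /fubini_F; apply: ae_ge0_le_integral => //.
- by move=> x _; apply: integral_ge0 => y _; rewrite lee_fin.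
- exact: (measurable_section_integral m1).
- by move=> x _; apply: integral_ge0 => y _; rewrite lee_fin.
- exact: (measurable_section_integral m2).
apply: (@filterS _ _ (ae_filter_ringOfSetsType leb) _ _ _ (weak_slices lf lg w)).
move=> x [lfx lgx hx] _.
have t0 : 0 < n.+1%:R^-1 :> R by rewrite invr_gt0.
apply: le_trans (window_int_pow_le k24 lgx t0); rewrite le_eqVlt; apply/orP; left; apply/eqP.
apply: ae_eq_integral => //.
- apply/measurable_EFinP; apply: measurable_funX.
  exact: (measurable_slice x (measurable_dq ord_max n.+1%:R^-1 mf)).
- apply/measurable_EFinP; apply: measurable_funX; apply: measurable_funM => //.
  by case: (window_int_locint lgx (ltW t0)).
- apply: (@filterS _ _ (ae_filter_ringOfSetsType leb) _ _ _ (hx n)) => y h _.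
  by rewrite /dq /sh /= h.
Qed.

End DifferenceQuotients.

(** * Both directions, and symmetry of mixed derivatives *)

Section WeakDerivatives.
Context {R : realType}.
Notation leb := (@lebesgue_measure R).
Notation mu2 := (leb \x leb)%E.
Notation locint := (@locally_integrable R setT).
Implicit Types (f g h : R * R -> R) (j : 'I_2).

Lemma smooth1_measurable (u : R -> R) : smooth1 u -> measurable_fun setT u.
Proof. by move=> su; apply: continuous_measurable_fun; exact: smooth1_continuous. Qed.

Lemma weak_pd_tensor2 f g (u v v' : R -> R) (M : R) : weak_pd ord_max f g ->
  smooth1 u -> smooth1 v ->
  (forall t, M < `|t| -> u t = 0) -> (forall t, M < `|t| -> v t = 0) ->
  (forall t : R, is_derive t 1 v (v' t)) ->
  (\int[mu2]_z (f z * (u z.1 * v' z.2))%:E = - \int[mu2]_z (g z * (u z.1 * v z.2))%:E)%E.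
Proof.
move=> w su sv uM vM dv; have := w _ (tensor_test_fun su sv uM vM).
by rewrite /leb2 (tensor_pd2 u dv).
Qed.

Lemma weak_pd_tensor1 f g (u v u' : R -> R) (M : R) : weak_pd ord0 f g ->
  smooth1 u -> smooth1 v ->
  (forall t, M < `|t| -> u t = 0) -> (forall t, M < `|t| -> v t = 0) ->
  (forall t : R, is_derive t 1 u (u' t)) ->
  (\int[mu2]_z (f z * (u' z.1 * v z.2))%:E = - \int[mu2]_z (g z * (u z.1 * v z.2))%:E)%E.
Proof.
move=> w su sv uM vM du; have := w _ (tensor_test_fun su sv uM vM).
by rewrite /leb2 (tensor_pd1 v du).
Qed.

Lemma smooth1_deriv_measurable (u u' : R -> R) : smooth1 u ->
  (forall t : R, is_derive t 1 u (u' t)) -> measurable_fun setT u'.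
Proof.
move=> /smooth1_closed[w sw dw] du.
suff -> : u' = w by exact: smooth1_measurable.
by apply/funext => t; case: (du t) => _ <-; case: (dw t) => _ <-.
Qed.

(** Swapping coordinates sends tensor products to tensor products, which transfers the results for
    the second variable to the first. *)
Lemma weakT2_swap f g : loc2 f -> loc2 g -> weak_pd ord0 f g ->
  weakT2 (fun z => f (swapR z)) (fun z => g (swapR z)).
Proof.
move=> [mf _] [mg _] w u v v' M su sv uM vM dv.
have mv' := smooth1_deriv_measurable sv dv.
have := weak_pd_tensor1 w sv su vM uM dv.
rewrite -(mpres_integral swapR_mpres); last first.
  apply/measurable_EFinP; apply: measurable_funM => //; apply: measurable_funM.
    exact: measurable_fst_comp.
  by apply: measurable_snd_comp; exact: smooth1_measurable.
rewrite -[in X in _ = X -> _](mpres_integral swapR_mpres); last first.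
  apply/measurable_EFinP; apply: measurable_funM => //; apply: measurable_funM.
    by apply: measurable_fst_comp; exact: smooth1_measurable.
  by apply: measurable_snd_comp; exact: smooth1_measurable.
under eq_integral do rewrite /swapR /= [v' _ * _]mulrC.
by under [in X in _ = X -> _]eq_integral do rewrite /swapR /= [v _ * _]mulrC.
Qed.

Lemma loc2_swap f : loc2 f -> loc2 (fun z => f (swapR z)).
Proof.
have [ms _] := @swapR_mpres R.
move=> [mf lf]; split; first exact: (measurableT_comp mf ms).
move=> phi M B mphi phiB phiM.
have H : mu2.-integrable setT (fun z => (f z * phi (swapR z))%:E).
  apply: (lf (fun z => phi (swapR z)) M B (measurableT_comp mphi ms)).
    by move=> z; exact: phiB.
  by move=> z [h|h]; apply: phiM; [right|left].
have := mpres_integrable swapR_mpres H.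
by apply: eq_integrable => // -[x y] _.
Qed.

Lemma weakT2_pd f g : weak_pd ord_max f g -> weakT2 f g.
Proof. by move=> w u v v' M; exact: weak_pd_tensor2. Qed.

Lemma dq_swap t f z : dq ord0 t f z = dq ord_max t (fun z => f (swapR z)) (swapR z).
Proof. by case: z => x y; rewrite /dq /sh /swapR. Qed.

Lemma dq_cvg j f g (o : bool) : loc2 f -> loc2 g -> weak_pd j f g ->
  {ae mu2, forall z, dq j ((-1) ^+ o * n.+1%:R^-1) f z @[n --> \oo] --> g z}.
Proof.
move=> lf lg; case: (ord2P j) => -> w; last exact: (dq_cvg2 o lf lg (weakT2_pd w)).
have := mpres_ae swapR_mpres (dq_cvg2 o (loc2_swap lf) (loc2_swap lg) (weakT2_swap lf lg w)).
apply: (@filterS _ _ (ae_filter_ringOfSetsType mu2)) => -[x y] /=.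
by apply: cvg_trans; apply: near_eq_cvg; apply: nearW => n /=; rewrite dq_swap.
Qed.

Lemma dq_pow_le j f g k n : k = 2%N \/ k = 4%N -> loc2 f -> loc2 g -> weak_pd j f g ->
  (\int[mu2]_z (dq j n.+1%:R^-1 f z ^+ k)%:E <= \int[mu2]_z (g z ^+ k)%:E)%E.
Proof.
move=> k24 lf lg; case: (ord2P j) => -> w; last exact: (dq_pow_le2 n k24 lf lg (weakT2_pd w)).
have [mf _] := lf; have [mg _] := lg.
have := dq_pow_le2 n k24 (loc2_swap lf) (loc2_swap lg) (weakT2_swap lf lg w).
rewrite -(mpres_integral swapR_mpres); last first.
  apply/measurable_EFinP; apply: measurable_funX; apply: measurable_dq.
  by case: (loc2_swap lf).
rewrite -[in X in (_ <= X)%E -> _](mpres_integral swapR_mpres); last first.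
  by apply/measurable_EFinP; apply: measurable_funX; case: (loc2_swap lg).
under eq_integral do rewrite -dq_swap.
by move=> h; apply: (le_trans h); rewrite le_eqVlt; apply/orP; left; apply/eqP; apply: eq_integral => -[x y] _.
Qed.

(** One variable at a time: the first plateau isolates almost every slice, the second shows that the
    slice vanishes. *)
Lemma loc2_ae_eq0 f : loc2 f ->
  (forall (p q r s : rat) m n, \int[mu2]_z
    (f z * (plateau (ratr p) (ratr q) m z.1 * plateau (ratr r) (ratr s) n z.2))%:E = 0)%E ->
  {ae mu2, forall z, f z = 0}.
Proof.
move=> lf hf; have [mf _] := lf.
have H : {ae leb, forall x, forall i : rat * rat * nat,
    let: (p, q, m) := i in
    (\int[leb]_y (f (x, y) * plateau (ratr p) (ratr q) m y)%:E = 0)%E}.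
  apply: ae_countable => -[[r s] n].
  apply: (@slice_integral_eq0 _ (fun z => f z * plateau (ratr r) (ratr s) n z.2)).
  - by apply: measurable_funM => //; apply: measurable_snd_comp; exact: measurable_plateau.
  - move=> M; pose N : R := Num.max M (Num.max `|ratr r| `|ratr s|).
    have cN (t : R) : N < `|t| -> cut M t = 0.
      by rewrite gt_max => /andP[h _]; exact: cut_out.
    have pN (t : R) : N < `|t| -> plateau (ratr r) (ratr s) n t = 0.
      by rewrite gt_max => /andP[_ h]; exact: plateau_supp.
    have := loc2_tensor lf (measurable_cut M) (measurable_plateau (ratr r) (ratr s) n)
      (cut_le1 M) (plateau_norm_le1 (ratr r) (ratr s) n) cN pN.
    by apply: eq_integrable => // z _; congr (_%:E); rewrite -[RHS]mulrA [cut _ _ * _]mulrC.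
  - move=> p q m; rewrite -(hf p q r s m n); apply: eq_integral => z _.
    by congr (_%:E); rewrite -mulrA; congr (_ * _); rewrite mulrC.
apply: ae_slices.
  rewrite (_ : [set z | _] = setT `&` (f @^-1` [set 0])); last by rewrite setTI.
  exact: mf.
apply: (@filterS2 _ _ (ae_filter_ringOfSetsType leb) _ _ _ _ H (loc2_slices lf)).
by move=> x hx lx; apply: locint_ae_eq0 => // p q m; exact: (hx (p, q, m)).
Qed.

Lemma loc2B f g : loc2 f -> loc2 g -> loc2 (fun z => f z - g z).
Proof.
move=> [mf lf] [mg lg]; split; first exact: measurable_funB.
move=> phi M B mphi phiB phiM.
have := integrableB measurableT (lf _ _ _ mphi phiB phiM) (lg _ _ _ mphi phiB phiM).
by apply: eq_integrable => // z _; rewrite mulrBl EFinB.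
Qed.

Lemma deriv_supp (u u' : R -> R) (M : R) : (forall t, M < `|t| -> u t = 0) ->
  (forall t : R, is_derive t 1 u (u' t)) -> forall t, M < `|t| -> u' t = 0.
Proof.
move=> uM du t Mt.
have : is_derive t 1 u 0.
  apply: (@near_eq_is_derive _ _ _ (cst 0)).
  near=> s; apply/esym/uM; near: s.
  have : `|s| @[s --> t] --> `|t| by exact: cvg_norm.
  by move=> /cvgr_gt; apply.
by case=> _ <-; case: (du t) => _ <-.
Unshelve. all: by end_near. Qed.

(** Against [a] times [b], both mixed derivatives integrate to the integral of [d] against a' times
    b', by two weak integrations by parts in opposite orders. *)
Lemma weak_mixed_sym d g0 g1 h01 h10 : loc2 h01 -> loc2 h10 ->
  weak_pd ord0 d g0 -> weak_pd ord_max d g1 ->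
  weak_pd ord_max g0 h01 -> weak_pd ord0 g1 h10 ->
  {ae mu2, forall z, h01 z = h10 z}.
Proof.
move=> l01 l10 w0 w1 w01 w10.
suff : {ae mu2, forall z, h01 z - h10 z = 0}.
  by apply: (@filterS _ _ (ae_filter_ringOfSetsType mu2)) => z /eqP; rewrite subr_eq0 => /eqP.
apply: loc2_ae_eq0; first exact: loc2B.
move=> p q r s m n.
set a := plateau (ratr p) (ratr q) m; set b := plateau (ratr r) (ratr s) n.
pose N : R := Num.max (Num.max `|ratr p| `|ratr q|) (Num.max `|ratr r| `|ratr s|).
have sa : smooth1 a by exact: plateau_smooth.
have sb : smooth1 b by exact: plateau_smooth.
have aN t : N < `|t| -> a t = 0 by rewrite gt_max => /andP[h _]; exact: plateau_supp.
have bN t : N < `|t| -> b t = 0 by rewrite gt_max => /andP[_ h]; exact: plateau_supp.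
have [a' sa' da] := smooth1_closed sa; have [b' sb' db] := smooth1_closed sb.
have a'N := deriv_supp aN da; have b'N := deriv_supp bN db.
have e1 := weak_pd_tensor2 w01 sa sb aN bN db.
have e2 := weak_pd_tensor1 w0 sa sb' aN b'N da.
have e3 := weak_pd_tensor1 w10 sa sb aN bN da.
have e4 := weak_pd_tensor2 w1 sa' sb a'N bN db.
have i1 : mu2.-integrable setT (fun z => (h01 z * (a z.1 * b z.2))%:E).
  exact: (loc2_tensor l01 (measurable_plateau _ _ _) (measurable_plateau _ _ _)
    (plateau_norm_le1 _ _ _) (plateau_norm_le1 _ _ _) aN bN).
have i2 : mu2.-integrable setT (fun z => (h10 z * (a z.1 * b z.2))%:E).
  exact: (loc2_tensor l10 (measurable_plateau _ _ _) (measurable_plateau _ _ _)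
    (plateau_norm_le1 _ _ _) (plateau_norm_le1 _ _ _) aN bN).
transitivity (\int[mu2]_z ((h01 z * (a z.1 * b z.2))%:E - (h10 z * (a z.1 * b z.2))%:E))%E.
  by apply: eq_integral => z _; rewrite -EFinB mulrBl.
rewrite integralB//.
have -> : (\int[mu2]_z (h01 z * (a z.1 * b z.2))%:E = \int[mu2]_z (h10 z * (a z.1 * b z.2))%:E)%E.
  by rewrite -[LHS]oppeK -e1 -[RHS]oppeK -e3 -[X in (- X)%E = _]oppeK -e2 -[X in _ = (- X)%E]oppeK -e4.
by rewrite subee//; exact: (integrable_fin_num measurableT i2).
Qed.

End WeakDerivatives.

(** * Majorants, and functions of zero integral *)

Section Domination.
Context {R : realType}.
Notation leb := (@lebesgue_measure R).
Notation mu2 := (leb \x leb)%E.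
Implicit Types (f g u v X Y : R * R -> R) (j : 'I_2).

(* What a majorant [X_ n] must satisfy in [lim_integral_eq0]; stable under sums. *)
Record dominated (X_ : nat -> R * R -> R) X : Prop := Dominated {
  dom_meas_seq : forall n, measurable_fun setT (X_ n);
  dom_meas : measurable_fun setT X;
  dom_seq_ge0 : forall n z, 0 <= X_ n z;
  dom_ge0 : forall z, 0 <= X z;
  dom_le : forall n, (\int[mu2]_z (X_ n z)%:E <= \int[mu2]_z (X z)%:E)%E;
  dom_lty : (\int[mu2]_z (X z)%:E < +oo)%E;
  dom_cvg : {ae mu2, forall z, X_ n z @[n --> \oo] --> X z} }.

Lemma dominatedD (X_ Y_ : nat -> R * R -> R) X Y : dominated X_ X -> dominated Y_ Y ->
  dominated (fun n z => X_ n z + Y_ n z) (fun z => X z + Y z).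
Proof.
move=> [mX_ mX X_0 X0 lX Xoo cX] [mY_ mY Y_0 Y0 lY Yoo cY].
have e (A B : R * R -> R) : measurable_fun setT A -> measurable_fun setT B ->
    (forall z, 0 <= A z) -> (forall z, 0 <= B z) ->
    (\int[mu2]_z (A z + B z)%:E = \int[mu2]_z (A z)%:E + \int[mu2]_z (B z)%:E)%E.
  move=> mA mB A0 B0; under eq_integral do rewrite EFinD.
  by apply: ge0_integralD => //; try (by move=> z _; rewrite lee_fin); exact/measurable_EFinP.
split.
- by move=> n; exact: measurable_funD.
- exact: measurable_funD.
- by move=> n z; exact: addr_ge0.
- by move=> z; exact: addr_ge0.
- by move=> n; rewrite !e//; exact: leeD.
- by rewrite e// lte_add_pinfty.
- apply: (@filterS2 _ _ (ae_filter_ringOfSetsType mu2) _ _ _ _ cX cY) => z h1 h2.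
  exact: cvgD.
Qed.

Lemma dominatedZ (c : R) (X_ : nat -> R * R -> R) X : 0 <= c -> dominated X_ X ->
  dominated (fun n z => c * X_ n z) (fun z => c * X z).
Proof.
move=> c0 [mX_ mX X_0 X0 lX Xoo cX].
have e (A : R * R -> R) : measurable_fun setT A -> (forall z, 0 <= A z) ->
    (\int[mu2]_z (c * A z)%:E = c%:E * \int[mu2]_z (A z)%:E)%E.
  move=> mA A0; under eq_integral do rewrite EFinM.
  by rewrite ge0_integralZl//; try (by move=> z _; rewrite lee_fin); exact/measurable_EFinP.
split.
- by move=> n; exact: measurable_funM.
- exact: measurable_funM.
- by move=> n z; exact: mulr_ge0.
- by move=> z; exact: mulr_ge0.
- by move=> n; rewrite !e// lee_wpmul2l.
- by rewrite e// lte_mul_pinfty.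
- apply: (@filterS _ _ (ae_filter_ringOfSetsType mu2) _ _ _ cX) => z h1.
  by apply: cvgM => //; exact: cvg_cst.
Qed.

Lemma dominated_cst X : measurable_fun setT X -> (forall z, 0 <= X z) ->
  (\int[mu2]_z (X z)%:E < +oo)%E -> dominated (fun _ => X) X.
Proof. by move=> mX X0 Xoo; split => //; apply: aeW => z; exact: cvg_cst. Qed.

(** Both signs are needed: the discrete null Lagrangian mixes forward and backward quotients. *)
Definition stp (o : bool) (n : nat) : R := (-1) ^+ o * n.+1%:R^-1.

Lemma stp_cvg o : stp o n @[n --> \oo] --> (0 : R).
Proof.
rewrite -[X in _ --> X](mulr0 ((-1) ^+ o)); apply: cvgM; first exact: cvg_cst.
exact: cvg_harmonic.
Qed.

Lemma stp_neq0 o n : stp o n != 0.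
Proof. by rewrite /stp mulf_neq0 ?signr_eq0// invr_eq0. Qed.

Lemma sh_addC j (s t : R) z : sh j s (sh j t z) = sh j (t + s) z.
Proof. by rewrite /sh; case: (j == ord0) => /=; rewrite addrA. Qed.

Lemma sh0 j (z : R * R) : sh j 0 z = z.
Proof. by case: z => x y; rewrite /sh; case: (j == ord0) => /=; rewrite addr0. Qed.

Lemma dqN j t f z : dq j (- t) f z = dq j t f (sh j (- t) z).
Proof. by rewrite /dq sh_addC addNr sh0 invrN mulNr -mulrN opprB. Qed.

(** The step times a convergent quotient tends to 0, so translates converge at [z] with no
    continuity assumed of [f]. *)
Lemma cvg_sh j o f z (l : R) : dq j (stp o n) f z @[n --> \oo] --> l ->
  f (sh j (stp o n) z) @[n --> \oo] --> f z.
Proof.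
move=> h.
have : f z + stp o n * dq j (stp o n) f z @[n --> \oo] --> f z + 0 * l.
  by apply: cvgD; [exact: cvg_cst|apply: cvgM => //; exact: stp_cvg].
rewrite mul0r addr0; apply: cvg_trans; apply: near_eq_cvg; apply: nearW => n /=.
by rewrite /dq mulrA mulfV ?stp_neq0// mul1r subrKC.
Qed.

Lemma sh_integral j t f : measurable_fun setT f ->
  (\int[mu2]_z (f (sh j t z))%:E = \int[mu2]_z (f z)%:E)%E.
Proof. by move=> mf; apply: (mpres_integral (sh_mpres j t)); exact/measurable_EFinP. Qed.

Lemma dominated_dq j o f g k : k = 2%N \/ k = 4%N -> loc2 f -> loc2 g -> weak_pd j f g ->
  (\int[mu2]_z (g z ^+ k)%:E < +oo)%E ->
  dominated (fun n z => dq j (stp o n) f z ^+ k) (fun z => g z ^+ k).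
Proof.
move=> k24 lf lg w goo; have [mf _] := lf; have [mg _] := lg.
have k0 (x : R) : 0 <= x ^+ k by apply: exprn_even_ge0; case: k24 => ->.
split => //.
- by move=> n; apply: measurable_funX; exact: measurable_dq.
- exact: measurable_funX.
- move=> n; rewrite /stp; case: o; rewrite ?expr0 ?expr1 ?mul1r ?mulN1r; last exact: dq_pow_le.
  (* A backward quotient is a translate of the forward one and has the same integrals. *)
  under eq_integral do rewrite dqN.
  rewrite (sh_integral j (- n.+1%:R^-1) (measurable_funX k (measurable_dq j n.+1%:R^-1 mf))).
  exact: dq_pow_le.
- apply: (@filterS _ _ (ae_filter_ringOfSetsType mu2) _ _ _ (dq_cvg o lf lg w)) => z h.
  by apply: (@continuous_cvg _ _ _ _ _ _ (fun x : R => x ^+ k)) => //; exact: exprn_continuous.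
Qed.

Lemma dominated_sh j f g k : k = 2%N \/ k = 4%N -> loc2 f -> loc2 g -> weak_pd j f g ->
  (\int[mu2]_z (f z ^+ k)%:E < +oo)%E ->
  dominated (fun n z => f (sh j (stp false n) z) ^+ k) (fun z => f z ^+ k).
Proof.
move=> k24 lf lg w foo; have [mf _] := lf; have [mg _] := lg.
have k0 (x : R) : 0 <= x ^+ k by apply: exprn_even_ge0; case: k24 => ->.
split => //.
- by move=> n; apply: measurable_funX; exact: measurable_fun_sh.
- exact: measurable_funX.
- move=> n.
  by rewrite (sh_integral j (stp false n) (measurable_funX k mf)).
- apply: (@filterS _ _ (ae_filter_ringOfSetsType mu2) _ _ _ (dq_cvg false lf lg w)) => z /cvg_sh h.
  by apply: (@continuous_cvg _ _ _ _ _ _ (fun x : R => x ^+ k)) => //; exact: exprn_continuous.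
Qed.

Definition null_int X := mu2.-integrable setT (EFin \o X) /\ (\int[mu2]_z (X z)%:E = 0)%E.

Lemma null_intD X Y : null_int X -> null_int Y -> null_int (fun z => X z + Y z).
Proof.
move=> [iX X0] [iY Y0]; split; first exact: (integrableD measurableT iX iY).
by under eq_integral do rewrite EFinD; rewrite integralD// X0 Y0 adde0.
Qed.

Lemma null_intZ (c : R) X : null_int X -> null_int (fun z => c * X z).
Proof.
move=> [iX X0]; split; first exact: (integrableZl measurableT c iX).
by under eq_integral do rewrite EFinM; rewrite integralZl// X0 mule0.
Qed.

Lemma null_int_sum (I : finType) (X : I -> R * R -> R) : (forall i, null_int (X i)) ->
  null_int (fun z => \sum_i X i z).
Proof.
move=> h; elim: (index_enum I) => [|i s ih].
  under eq_fun do rewrite big_nil.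
  by split; [exact: integrable0|exact: integral0].
by under eq_fun do rewrite big_cons; exact: null_intD.
Qed.

(** The discrete form of a divergence; both integrations by parts are limits of combinations of such
    differences. *)
Lemma null_int_mpres (phi : R * R -> R * R) X : mpres mu2 phi ->
  mu2.-integrable setT (EFin \o X) -> null_int (fun z => X (phi z) - X z).
Proof.
move=> mp iX; have iXp := mpres_integrable mp iX.
split; first exact: (integrableB measurableT iXp iX).
under eq_integral do rewrite EFinB.
rewrite integralB//.
have -> : (\int[mu2]_z (X (phi z))%:E = \int[mu2]_z (X z)%:E)%E.
  exact: (mpres_integral mp (measurable_int _ iX)).
by rewrite subee//; exact: (integrable_fin_num measurableT iX).
Qed.

Lemma null_int_dominated (f_ X_ : nat -> R * R -> R) f X : dominated X_ X ->
  (forall n, measurable_fun setT (f_ n)) -> measurable_fun setT f ->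
  (forall n z, `|f_ n z| <= X_ n z) ->
  {ae mu2, forall z, f_ n z @[n --> \oo] --> f z} ->
  (forall n, null_int (f_ n)) -> null_int f.
Proof.
move=> [mX_ mX X_0 X0 lX Xoo cX] mf_ mf fX cf f0.
apply: (@lim_integral_eq0 _ _ _ mu2 f_ X_ f X) => //.
by move=> n; case: (f0 n).
Qed.

Lemma integrable_L2M u v : L2 u -> L2 v -> mu2.-integrable setT (fun z => (u z * v z)%:E).
Proof.
move=> [mu_]; rewrite /leb2 => u2 [mv]; rewrite /leb2 => v2.
have i (w : R * R -> R) : measurable_fun setT w -> (\int[mu2]_z (w z ^+ 2)%:E < +oo)%E ->
    mu2.-integrable setT (fun z : R * R => (w z ^+ 2)%:E).
  move=> mw w2; apply/integrableP; split; first by apply/measurable_EFinP; exact: measurable_funX.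
  by under eq_integral do rewrite gee0_abs ?lee_fin ?sqr_ge0//.
apply: le_integrable (integrableD measurableT (i _ mu_ u2) (i _ mv v2)) => //.
  by apply/measurable_EFinP; exact: measurable_funM.
move=> z _; rewrite -EFinD /= lee_fin [leRHS]ger0_norm ?addr_ge0 ?sqr_ge0//.
exact: norm_mul_le_sqr.
Qed.

Lemma L2_sh j t u : L2 u -> L2 (fun z => u (sh j t z)).
Proof.
move=> [mu_ u2]; split; first exact: measurable_fun_sh.
by rewrite /leb2 (sh_integral j t (measurable_funX 2 mu_)).
Qed.

End Domination.

(** * The two integrations by parts *)

Section NullIntegrals.
Context {R : realType}.
Notation leb := (@lebesgue_measure R).
Notation mu2 := (leb \x leb)%E.
Implicit Types (f g u v X Y : R * R -> R) (j : 'I_2).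

(** The adjoint of a forward quotient is minus the backward one. Hence the product of forward
    quotients and the product of backward quotients with exchanged directions have equal integrals
    already before the limit, which dictates the signs in [f_]. *)
Lemma null_lagrangian u v u0 u1 v0 v1 : L2 u -> L2 v -> L2 u0 -> L2 u1 -> L2 v0 -> L2 v1 ->
  weak_pd ord0 u u0 -> weak_pd ord_max u u1 -> weak_pd ord0 v v0 -> weak_pd ord_max v v1 ->
  null_int (fun z => u1 z * v0 z - u0 z * v1 z).
Proof.
move=> Lu Lv Lu0 Lu1 Lv0 Lv1 w0 w1 x0 x1.
have lu := loc2_L2 Lu; have lv := loc2_L2 Lv.
have [mu_ _] := Lu; have [mv _] := Lv.
have k2 : 2%N = 2%N \/ 2%N = 4%N by left.
have dom f g j o : L2 f -> L2 g -> weak_pd j f g ->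
    dominated (fun n z => dq j (stp o n) f z ^+ 2) (fun z => g z ^+ 2).
  move=> Lf Lg w; apply: (dominated_dq o k2 (loc2_L2 Lf) (loc2_L2 Lg) w).
  by case: Lg => _; rewrite /leb2.
have D := dominatedD
  (dominatedD (dom _ _ _ false Lu Lu1 w1) (dom _ _ _ false Lv Lv0 x0))
  (dominatedD (dom _ _ _ true Lu Lu0 w0) (dom _ _ _ true Lv Lv1 x1)).
pose f_ n z := dq ord_max (stp false n) u z * dq ord0 (stp false n) v z -
  dq ord0 (stp true n) u z * dq ord_max (stp true n) v z.
apply: (@null_int_dominated _ f_ _ _ _ D).
- by move=> n; apply: measurable_funB; apply: measurable_funM; exact: measurable_dq.
- by case: Lu0 Lu1 Lv0 Lv1 => [? _] [? _] [? _] [? _];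
    apply: measurable_funB; exact: measurable_funM.
- move=> n z; rewrite /f_; apply: (le_trans (ler_normB _ _)).
  by apply: lerD; exact: norm_mul_le_sqr.
- have c1 := dq_cvg false lu (loc2_L2 Lu1) w1.
  have c2 := dq_cvg false lv (loc2_L2 Lv0) x0.
  have c3 := dq_cvg true lu (loc2_L2 Lu0) w0.
  have c4 := dq_cvg true lv (loc2_L2 Lv1) x1.
  have := ae_and (ae_and c1 c2) (ae_and c3 c4).
  apply: (@filterS _ _ (ae_filter_ringOfSetsType mu2)) => z [[h1 h2] [h3 h4]].
  by apply: cvgB; exact: cvgM.
- move=> n; pose t : R := n.+1%:R^-1.
  have t0 : t != 0 by rewrite invr_eq0.
  (* Summation by parts: each of the three pieces is a function minus its translate. *)
  pose X1 z := u (sh ord0 (- t) z) * v (sh ord_max (- t) z).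
  pose X2 z := u z * v (sh ord_max (- t) z).
  pose X3 z := u (sh ord0 (- t) z) * v z.
  have i1 : mu2.-integrable setT (EFin \o X1) by apply: integrable_L2M; exact: L2_sh.
  have i2 : mu2.-integrable setT (EFin \o X2) by apply: integrable_L2M => //; exact: L2_sh.
  have i3 : mu2.-integrable setT (EFin \o X3) by apply: integrable_L2M => //; exact: L2_sh.
  have mp : mpres mu2 (fun z => sh ord0 t (sh ord_max t z)).
    have [m1 h1] := sh_mpres ord0 t; have [m2 h2] := sh_mpres ord_max t.
    split; first exact: (measurableT_comp m1 m2).
    move=> A mA; rewrite -[in RHS](h1 A mA) -[RHS]h2//.
    by rewrite -[X in measurable X]setTI; exact: m1.
  have n1 := null_intZ (t^-1 ^+ 2) (null_int_mpres mp i1).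
  have n2 := null_intZ (- t^-1 ^+ 2) (null_int_mpres (sh_mpres ord_max t) i2).
  have n3 := null_intZ (- t^-1 ^+ 2) (null_int_mpres (sh_mpres ord0 t) i3).
  suff -> : f_ n = (fun z => t^-1 ^+ 2 * (X1 (sh ord0 t (sh ord_max t z)) - X1 z) +
      (- t^-1 ^+ 2 * (X2 (sh ord_max t z) - X2 z) + - t^-1 ^+ 2 * (X3 (sh ord0 t z) - X3 z))).
    exact: null_intD n1 (null_intD n2 n3).
  apply/funext => -[x y]; rewrite /f_ /X1 /X2 /X3 /stp /dq /sh /= expr0 expr1 mul1r mulN1r.
  rewrite -/t !addrK; field; exact: t0.
Qed.

(** [P], [Q], [S] are the quotients of [u], [v], [s], and primes mark translated values; the left
    side is the discrete Leibniz rule for u^2 v / s. Squares of [P] and [Q] but fourth powers of the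
    rest match the available integrability. The three terms cost 2 W, W and 2 W^2, within the factor
    on the right. *)
Lemma divergence_bound (W P Q S u v u' v' s s' : R) : 0 < W ->
  0 <= s^-1 /\ s^-1 <= W -> 0 <= s'^-1 /\ s'^-1 <= W ->
  `|P * (u' + u) * v' / s' + u ^+ 2 * Q / s' - u ^+ 2 * v * S / (s * s')| <=
  4 * (W + W ^+ 2) * (P ^+ 2 + (Q ^+ 2 + S ^+ 4) + (u ^+ 4 + u' ^+ 4 + (v ^+ 4 + v' ^+ 4))).
Proof.
move=> W0 [w0 wW] [w0' wW'].
have e4 (x : R) : x ^+ 4 = (x ^+ 2) ^+ 2 by rewrite -exprM.
have p4 (x : R) : 0 <= x ^+ 4 by rewrite exprn_even_ge0.
set T := (X in _ <= _ * X).
have b1 : `|P * (u' + u) * v' / s'| <= W * (2 * T).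
  rewrite normrM (ger0_norm w0') mulrC ler_pM// -mulrA.
  apply: (le_trans (norm_mul_le_sqr _ _)); rewrite /T.
  have h : ((u' + u) * v') ^+ 2 <= u' ^+ 4 + u ^+ 4 + 2 * v' ^+ 4.
    rewrite exprMn !e4.
    have h1 : (u' + u) ^+ 2 <= 2 * (u' ^+ 2 + u ^+ 2) by have := sqr_ge0 (u' - u); rewrite !expr2; nra.
    apply: (le_trans (ler_wpM2r (sqr_ge0 v') h1)).
    have := sqr_ge0 (u' ^+ 2 - v' ^+ 2); have := sqr_ge0 (u ^+ 2 - v' ^+ 2).
    by move: (u ^+ 2) (u' ^+ 2) (v' ^+ 2) => A B C; rewrite !expr2; nra.
  by have := sqr_ge0 Q; have := p4 S; have := p4 u; have := p4 u'; have := p4 v; have := p4 v';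
    have := sqr_ge0 P; lra.
have b2 : `|u ^+ 2 * Q / s'| <= W * T.
  rewrite normrM (ger0_norm w0') mulrC ler_pM//.
  apply: (le_trans (norm_mul_le_sqr _ _)); rewrite /T -exprM.
  by have := sqr_ge0 P; have := p4 S; have := p4 u'; have := p4 v; have := p4 v'; lra.
have b3 : `|u ^+ 2 * v * S / (s * s')| <= W ^+ 2 * (2 * T).
  rewrite normrM [`|(s * s')^-1|]ger0_norm; last by rewrite invfM mulr_ge0.
  rewrite mulrC ler_pM//; first by rewrite invfM mulr_ge0.
    by rewrite invfM expr2 ler_pM.
  rewrite -mulrA; apply: (le_trans (norm_mul_le_sqr _ _)); rewrite /T -exprM exprMn.
  have h : v ^+ 2 * S ^+ 2 <= v ^+ 4 + S ^+ 4.
    by rewrite !e4; apply: le_trans (norm_mul_le_sqr _ _); exact: ler_norm.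
  by have := sqr_ge0 P; have := sqr_ge0 Q; have := p4 S; have := p4 u; have := p4 u'; have := p4 v; have := p4 v'; lra.
apply: (le_trans (ler_normB _ _)); apply: (le_trans (lerD (ler_normD _ _) (lexx _))).
have T0 : 0 <= T.
  by rewrite /T; have := sqr_ge0 P; have := sqr_ge0 Q; have := p4 S; have := p4 u; have := p4 u'; have := p4 v; have := p4 v'; lra.
have WT : 0 <= W * T by rewrite mulr_ge0// ltW.
have W2T : 0 <= W ^+ 2 * T by rewrite mulr_ge0// sqr_ge0.
have -> : 4 * (W + W ^+ 2) * T = 4 * (W * T) + 4 * (W ^+ 2 * T) by ring.
have b1' : W * (2 * T) = 2 * (W * T) by ring.
have b3' : W ^+ 2 * (2 * T) = 2 * (W ^+ 2 * T) by ring.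
rewrite b1' in b1; rewrite b3' in b3.
by move: (W * T) (W ^+ 2 * T) b1 b2 b3 WT W2T => *; lra.
Qed.

Lemma measurable_invr_gt0 f : measurable_fun setT f -> (forall z, 0 < f z) ->
  measurable_fun setT (fun z : R * R => (f z)^-1).
Proof.
move=> mf f0.
rewrite (_ : (fun z => _) = (fun z => expR (- ln (f z)))); last first.
  by apply/funext => z; rewrite expRN lnK// posrE.
apply: (measurableT_comp (@measurable_expR R)); apply: measurableT_comp => //.
exact: (measurableT_comp (@measurable_ln R)).
Qed.

(** The integrand is the derivative of u^2 v / s in direction [k], since v is the derivative of s.
    With u = g_j, v = d_k d_3 and s = d_3, summing over components and directions gives the
    divergence of e (grad d_3) / d_3. *)
Lemma null_divergence (eps : R) u v s a b k : 0 < eps -> L2 u -> L2 v -> L2 a -> L2 b ->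
  (\int[mu2]_z (u z ^+ 4)%:E < +oo)%E -> (\int[mu2]_z (v z ^+ 4)%:E < +oo)%E ->
  measurable_fun setT s -> (forall z, eps <= s z) -> (forall z, `|s z| <= 1) ->
  weak_pd k u a -> weak_pd k v b -> weak_pd k s v ->
  null_int (fun z => (2 * u z * a z * v z + u z ^+ 2 * b z) / s z - u z ^+ 2 * v z ^+ 2 / s z ^+ 2).
Proof.
move=> e0 Lu Lv La Lb u4 v4 ms se s1 wu wv ws.
have lu := loc2_L2 Lu; have lv := loc2_L2 Lv; have la := loc2_L2 La; have lb := loc2_L2 Lb.
have ls := loc2_bounded ms s1.
have [mu_ _] := lu; have [mv _] := lv; have [ma _] := la; have [mb _] := lb.
have k2 : 2%N = 2%N \/ 2%N = 4%N by left.
have k4 : 4%N = 2%N \/ 4%N = 4%N by right.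
have s0 (z : R * R) : 0 < s z by apply: lt_le_trans (se z).
have sn (z : R * R) : s z != 0 by rewrite gt_eqF.
have m4 f : measurable_fun setT f -> measurable_fun setT (fun z => f z ^+ 4).
  by move=> mf; exact: measurable_funX.
have p4 (f : R * R -> R) z : 0 <= f z ^+ 4 by rewrite exprn_even_ge0.
pose W := eps^-1.
have W0 : 0 < W by rewrite invr_gt0.
have sW (z : R * R) : (s z)^-1 <= W by rewrite /W lef_pV2 ?posrE.
have siW (z : R * R) : 0 < (s z)^-1 by rewrite invr_gt0.
have dP := dominated_dq false k2 lu la wu (proj2 La).
have dQ := dominated_dq false k2 lv lb wv (proj2 Lb).
have dS := dominated_dq false k4 ls lv ws v4.
have du := dominated_cst (m4 _ mu_) (p4 u) u4.
have dv := dominated_cst (m4 _ mv) (p4 v) v4.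
have du' := dominated_sh k4 lu la wu u4.
have dv' := dominated_sh k4 lv lb wv v4.
have C0 : 0 <= 4 * (W + W ^+ 2) by have := sqr_ge0 W; lra.
have D := dominatedZ C0 (dominatedD (dominatedD dP (dominatedD dQ dS))
  (dominatedD (dominatedD du du') (dominatedD dv dv'))).
pose F z := u z ^+ 2 * v z / s z.
have mVs : measurable_fun setT (fun z : R * R => (s z)^-1) by exact: measurable_invr_gt0.
have mF : measurable_fun setT F.
  by apply: measurable_funM => //; apply: measurable_funM => //; exact: measurable_funX.
(* Integrability follows from |u^2 v| <= u^4 + v^2 and 1/s <= W. *)
have iF : mu2.-integrable setT (EFin \o F).
  have iu4 : mu2.-integrable setT (fun z : R * R => (u z ^+ 4)%:E).
    apply/integrableP; split; first by apply/measurable_EFinP; exact: m4.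
    by under eq_integral do rewrite gee0_abs ?lee_fin ?p4//.
  have iv2 := integrable_L2M Lv Lv.
  apply: le_integrable (integrableZl measurableT W (integrableD measurableT iu4 iv2)) => //.
    exact/measurable_EFinP.
  move=> z _; rewrite -EFinD -EFinM /= lee_fin [leRHS]ger0_norm; last first.
    by rewrite mulr_ge0 ?(ltW W0)// addr_ge0 ?p4// -expr2 sqr_ge0.
  rewrite /F normrM (ger0_norm (ltW (siW z))) mulrC ler_pM ?normr_ge0 ?(ltW (siW z))//.
  apply: (le_trans (norm_mul_le_sqr _ _)).
  by rewrite -exprM -expr2.
pose f_ n := dq k (stp false n) F.
have fE n z : f_ n z =
   dq k (stp false n) u z * (u (sh k (stp false n) z) + u z) * v (sh k (stp false n) z) / s (sh k (stp false n) z)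
   + u z ^+ 2 * dq k (stp false n) v z / s (sh k (stp false n) z)
   - u z ^+ 2 * v z * dq k (stp false n) s z / (s z * s (sh k (stp false n) z)).
  rewrite /f_ /F /dq; field.
  by rewrite (stp_neq0 false n) !sn.
apply: (@null_int_dominated _ f_ _ _ _ D).
- by move=> n; exact: measurable_dq.
- apply: measurable_funB; last first.
    apply: measurable_funM; first by apply: measurable_funM; exact: measurable_funX.
    apply: measurable_invr_gt0; first exact: measurable_funX.
    by move=> z; exact: exprn_gt0.
  apply: measurable_funM => //; apply: measurable_funD.
    by apply: measurable_funM => //; apply: measurable_funM => //; exact: measurable_funM.
  by apply: measurable_funM => //; exact: measurable_funX.
- move=> n z; rewrite fE; apply: divergence_bound => //.
  + by split; [exact: ltW|exact: sW].
  + by split; [exact: ltW|exact: sW].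
- have := ae_and (ae_and (dq_cvg false lu la wu) (dq_cvg false lv lb wv)) (dq_cvg false ls lv ws).
  apply: (@filterS _ _ (ae_filter_ringOfSetsType mu2)) => z [[h1 h2] h3].
  have c1 := cvg_sh h1; have c2 := cvg_sh h2; have c3 := cvg_sh h3.
  rewrite (_ : _ - _ = a z * (u z + u z) * v z / s z + u z ^+ 2 * b z / s z
    - u z ^+ 2 * v z * v z / (s z * s z)); last by field.
  under eq_fun do rewrite fE.
  have cV : (s (sh k (stp false n) z))^-1 @[n --> \oo] --> (s z)^-1 by exact: cvgV.
  apply: cvgB; first apply: cvgD.
  + apply: cvgM => //; apply: cvgM => //; apply: cvgM => //; apply: cvgD => //; exact: cvg_cst.
  + by apply: cvgM => //; apply: cvgM => //; exact: cvg_cst.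
  + apply: cvgM; first by apply: cvgM => //; exact: cvg_cst.
    apply: cvgV; first by rewrite mulf_neq0.
    by apply: cvgM => //; exact: cvg_cst.
- move=> n; apply: (@null_intZ _ (stp false n)^-1 (fun z => F (sh k (stp false n) z) - F z)).
  by apply: null_int_mpres; [exact: sh_mpres|].
Qed.

End NullIntegrals.

(** * Maps into the sphere *)

Section Sphere.
Context {R : realType}.
Notation leb := (@lebesgue_measure R).
Notation mu2 := (leb \x leb)%E.
Notation i2 := (Ordinal (isT : (2 < 3)%N)).

Lemma sum2 (V : zmodType) (F : 'I_2 -> V) : \sum_(j < 2) F j = F ord0 + F ord_max.
Proof. by rewrite big_ord_recl big_ord1; congr (_ + F _); apply/val_inj. Qed.

Lemma sum3 (V : zmodType) (F : 'I_3 -> V) :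
  \sum_(i < 3) F i = F ord0 + F (Ordinal (isT : (1 < 3)%N)) + F i2.
Proof.
rewrite !big_ord_recl big_ord0 addr0 addrA.
by congr (_ + F _ + F _); apply/val_inj.
Qed.

(** The normal component of [h] is - G, so adding G d removes it and lowers the square by G^2; as
    [g] is tangent, it has no cross term with [d]. *)
Lemma completed_square (d g h : 'I_3 -> R) (G r : R) :
  \sum_i d i ^+ 2 = 1 -> \sum_i d i * g i = 0 -> \sum_i d i * h i = - G ->
  0 <= \sum_i h i ^+ 2 - G ^+ 2 - 2 * r * \sum_i h i * g i + r ^+ 2 * \sum_i g i ^+ 2.
Proof.
move=> d1 dg dh.
suff <- : \sum_i (h i + d i * G - g i * r) ^+ 2 =
    \sum_i h i ^+ 2 - G ^+ 2 - 2 * r * \sum_i h i * g i + r ^+ 2 * \sum_i g i ^+ 2.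
  by apply: sumr_ge0 => i _; exact: sqr_ge0.
have -> : \sum_i (h i + d i * G - g i * r) ^+ 2 =
    \sum_i h i ^+ 2 + 2 * G * \sum_i d i * h i + G ^+ 2 * \sum_i d i ^+ 2
    - 2 * r * \sum_i h i * g i - 2 * G * r * \sum_i d i * g i + r ^+ 2 * \sum_i g i ^+ 2.
  by rewrite !sum3; ring.
by rewrite d1 dg dh; ring.
Qed.

(** * The pointwise inequality *)

Section Pointwise.
Variables (eps : R) (d : 'I_3 -> R) (g : 'I_3 -> 'I_2 -> R) (h : 'I_3 -> 'I_2 -> 'I_2 -> R).
Hypothesis eps0 : 0 < eps.
Hypothesis d1 : \sum_i d i ^+ 2 = 1.
Hypothesis d3 : eps <= d i2.
Hypothesis dg : forall j, \sum_i d i * g i j = 0.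
Hypothesis dh : forall j k, \sum_i (g i j * g i k + d i * h i j k) = 0.
Hypothesis hsym : forall i, h i ord0 ord_max = h i ord_max ord0.

Let e := \sum_(i < 3) \sum_(j < 2) g i j ^+ 2.
Let lap i := \sum_(j < 2) h i j j.
Let tau i := lap i + e * d i.

Lemma lap_normal : \sum_i d i * lap i = - e.
Proof.
have h0 := dh ord0 ord0; have h1 := dh ord_max ord_max.
have : \sum_i d i * lap i + e = \sum_i (g i ord0 * g i ord0 + d i * h i ord0 ord0) +
    \sum_i (g i ord_max * g i ord_max + d i * h i ord_max ord_max).
  by rewrite /e /lap !sum3 !sum2; ring.
by rewrite h0 h1 addr0 => /eqP; rewrite addr_eq0 => /eqP.
Qed.

Lemma tension_norm : \sum_i tau i ^+ 2 = \sum_i lap i ^+ 2 - e ^+ 2.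
Proof.
have -> : \sum_i tau i ^+ 2 =
    \sum_i lap i ^+ 2 + 2 * e * \sum_i d i * lap i + e ^+ 2 * \sum_i d i ^+ 2.
  by rewrite /tau !sum3; ring.
by rewrite lap_normal d1; ring.
Qed.

Lemma energy_le_lap : e ^+ 2 <= \sum_i lap i ^+ 2.
Proof.
rewrite -subr_ge0 -tension_norm; apply: sumr_ge0 => i _; exact: sqr_ge0.
Qed.

(** The last two terms on the right have zero integral, so integration leaves a bound of the energy
    by the tension. *)
Lemma pointwise_bound :
  e ^+ 2 / 4 <= (1 + eps^-1 ^+ 2) * \sum_i tau i ^+ 2
  + 2 * (\sum_i (h i ord0 ord_max * h i ord_max ord0 - h i ord0 ord0 * h i ord_max ord_max))
  - \sum_i \sum_j \sum_k
      ((2 * g i j * h i j k * g i2 k + g i j ^+ 2 * h i2 k k) / d i2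
       - g i j ^+ 2 * g i2 k ^+ 2 / d i2 ^+ 2).
Proof.
have d30 : 0 < d i2 by apply: lt_le_trans d3.
pose w := (d i2)^-1.
have w0 : 0 < w by rewrite invr_gt0.
have ww : w <= eps^-1 by rewrite lef_pV2.
pose G j k := \sum_i g i j * g i k.
have hG j k : \sum_i d i * h i j k = - G j k.
  by apply/eqP; rewrite -addr_eq0 addrC /G -big_split /= dh.
pose r k := g i2 k * w.
have q j k := completed_square (r k) d1 (dg j) (hG j k).
have q00 := q ord0 ord0; have q01 := q ord0 ord_max.
have q10 := q ord_max ord0; have q11 := q ord_max ord_max.
(* The divergence splits into what the completed squares contain and e (lap d_3) / d_3. *)
have eA : \sum_i \sum_j \sum_k
      ((2 * g i j * h i j k * g i2 k + g i j ^+ 2 * h i2 k k) / d i2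
       - g i j ^+ 2 * g i2 k ^+ 2 / d i2 ^+ 2) =
  \sum_j \sum_k (2 * r k * (\sum_i h i j k * g i j) - r k ^+ 2 * \sum_i g i j ^+ 2)
  + e * w * lap i2.
  by rewrite /e /lap /r -exprVn -/w !sum3 !sum2 !sum3; ring.
rewrite eA {eA} tension_norm.
have el : e * w * lap i2 = w * (e * tau i2) - e ^+ 2.
  by rewrite /tau /w; field; rewrite gt_eqF.
(* With symmetric second derivatives the null Lagrangian is exactly what separates |lap d|^2 from
   the full Hessian. *)
have hs : \sum_i lap i ^+ 2 + 2 * (\sum_i (h i ord0 ord_max * h i ord_max ord0 - h i ord0 ord0 * h i ord_max ord_max))
   = \sum_i h i ord0 ord0 ^+ 2 + \sum_i h i ord0 ord_max ^+ 2 + \sum_i h i ord_max ord0 ^+ 2 + \sum_i h i ord_max ord_max ^+ 2.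
  by rewrite /lap !sum3 !sum2 !hsym; ring.
have eG : e = G ord0 ord0 + G ord_max ord_max.
  by rewrite /e /G !sum3 !sum2; ring.
(* The matrix [G] has trace [e], hence squared norm at least e^2 / 2. *)
have G2 : e ^+ 2 / 2 <= G ord0 ord0 ^+ 2 + G ord0 ord_max ^+ 2 + G ord_max ord0 ^+ 2 + G ord_max ord_max ^+ 2.
  rewrite eG; have := sqr_ge0 (G ord0 ord0 - G ord_max ord_max).
  have := sqr_ge0 (G ord0 ord_max); have := sqr_ge0 (G ord_max ord0).
  by move: (G ord0 ord0) (G ord_max ord_max) (G ord0 ord_max) (G ord_max ord0) => *; nra.
have t3 : tau i2 ^+ 2 <= \sum_i lap i ^+ 2 - e ^+ 2.
  rewrite -tension_norm sum3 lerDr addr_ge0 ?sqr_ge0//.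
(* Young's inequality with weight 1/4 spends half of the available e^2 / 2, leaving e^2 / 4. *)
have wt : w * (e * tau i2) <= e ^+ 2 / 4 + eps^-1 ^+ 2 * (\sum_i lap i ^+ 2 - e ^+ 2).
  have a1 : w * (e * tau i2) <= e ^+ 2 / 4 + w ^+ 2 * tau i2 ^+ 2.
    have yg (a b c : R) : a * (b * c) <= b ^+ 2 / 4 + a ^+ 2 * c ^+ 2.
      by have := sqr_ge0 (b / 2 - a * c); nra.
    exact: yg.
  apply: (le_trans a1); rewrite lerD2l ler_pM ?sqr_ge0//.
  by rewrite lerXn2r ?nnegrE ?(ltW w0) ?invr_ge0 ?(ltW eps0).
rewrite el !sum2.
move: hs G2 wt q00 q01 q10 q11.
set L := \sum_i lap i ^+ 2; set B := \sum_i (_ - _).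
set H00 := \sum_i h i ord0 ord0 ^+ 2; set H01 := \sum_i h i ord0 ord_max ^+ 2.
set H10 := \sum_i h i ord_max ord0 ^+ 2; set H11 := \sum_i h i ord_max ord_max ^+ 2.
move: (w * (e * tau i2)) => Y.
move: (\sum_i h i ord0 ord0 * g i ord0) (\sum_i h i ord0 ord_max * g i ord0).
move=> S00 S01.
move: (\sum_i h i ord_max ord0 * g i ord_max) (\sum_i h i ord_max ord_max * g i ord_max).
move=> S10 S11.
move: (\sum_i g i ord0 ^+ 2) (\sum_i g i ord_max ^+ 2) => g0 g1.
move: (G ord0 ord0 ^+ 2) (G ord0 ord_max ^+ 2) (G ord_max ord0 ^+ 2) (G ord_max ord_max ^+ 2) => A00 A01 A10 A11.
have -> : 2 * r ord0 * S00 = 2 * (r ord0 * S00) by ring.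
have -> : 2 * r ord_max * S01 = 2 * (r ord_max * S01) by ring.
have -> : 2 * r ord0 * S10 = 2 * (r ord0 * S10) by ring.
have -> : 2 * r ord_max * S11 = 2 * (r ord_max * S11) by ring.
rewrite (mulrDl 1 (eps^-1 ^+ 2)) mul1r.
move: (r ord0 * S00) (r ord_max * S01) (r ord0 * S10) (r ord_max * S11) => Z00 Z01 Z10 Z11.
move: (r ord0 ^+ 2 * g0) (r ord_max ^+ 2 * g0) (r ord0 ^+ 2 * g1) (r ord_max ^+ 2 * g1) => ? ? ? ?.
move: (eps^-1 ^+ 2 * (L - e ^+ 2)) (e ^+ 2) => ? ? hs.
lra.
Qed.

End Pointwise.
End Sphere.

(** * From weak derivatives to the integral estimate *)

Section SphereMaps.
Context {R : realType}.
Notation leb := (@lebesgue_measure R).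
Notation mu2 := (leb \x leb)%E.
Notation i2 := (Ordinal (isT : (2 < 3)%N)).
Variables (d : 'I_3 -> R * R -> R) (g : 'I_3 -> 'I_2 -> R * R -> R)
  (h : 'I_3 -> 'I_2 -> 'I_2 -> R * R -> R).
Hypothesis d1 : forall x, \sum_(i < 3) d i x ^+ 2 = 1.
Hypothesis md : forall i, measurable_fun [set: R * R] (d i).
Hypothesis wd : forall i j, weak_pd j (d i) (g i j).
Hypothesis wg : forall i j k, weak_pd k (g i j) (h i j k).
Hypothesis Lg : forall i j, L2 (g i j).
Hypothesis Lh : forall i j k, L2 (h i j k).

Lemma sphere_norm_le1 i x : `|d i x| <= 1.
Proof.
have h1 : d i x ^+ 2 <= 1.
  by rewrite -(d1 x) (bigD1 i)//= lerDl; apply: sumr_ge0 => k _; exact: sqr_ge0.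
by rewrite -(@ler_pXn2r _ 2) ?nnegrE// real_normK ?num_real// expr1n.
Qed.

Let ld i : loc2 (d i) := loc2_bounded (md i) (sphere_norm_le1 i).
Let lg i j : loc2 (g i j) := loc2_L2 (Lg i j).
Let lh i j k : loc2 (h i j k) := loc2_L2 (Lh i j k).

Lemma ae_dq_d j : {ae mu2, forall z, forall i,
  dq j (stp false n) (d i) z @[n --> \oo] --> g i j z}.
Proof. by apply: ae_countable => i; exact: (dq_cvg false (ld i) (lg i j) (wd i j)). Qed.

Lemma ae_dq_g j k : {ae mu2, forall z, forall i,
  dq k (stp false n) (g i j) z @[n --> \oo] --> h i j k z}.
Proof. by apply: ae_countable => i; exact: (dq_cvg false (lg i j) (lh i j k) (wg i j k)). Qed.

Lemma cvg_cst0_eqr (u : nat -> R) (l : R) : (forall n, u n = 0) -> u n @[n --> \oo] --> l -> l = 0.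
Proof.
move=> u0 ul; apply: (cvg_unique _ ul); first exact: Rhausdorff.
by rewrite (_ : u = cst 0); [exact: cvg_cst|apply/funext].
Qed.

(** The quotient of |d|^2 is exactly 0 and factors as the quotient of d times the sum of two values
    of d; the limit is 2 <d, g_j>. *)
Lemma grad_tangent : {ae mu2, forall z, forall j, \sum_i d i z * g i j z = 0}.
Proof.
apply: ae_countable => j.
apply: (@filterS _ _ (ae_filter_ringOfSetsType mu2) _ _ _ (ae_dq_d j)) => z hz.
pose u n := \sum_i dq j (stp false n) (d i) z * (d i (sh j (stp false n) z) + d i z).
have u0 n : u n = 0.
  transitivity ((stp false n)^-1 * (\sum_i d i (sh j (stp false n) z) ^+ 2 - \sum_i d i z ^+ 2)).
    by rewrite /u /dq !sum3; ring.
  by rewrite !d1 subrr mulr0.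
have cu : u n @[n --> \oo] --> \sum_i g i j z * (d i z + d i z).
  have c i : dq j (stp false n) (d i) z * (d i (sh j (stp false n) z) + d i z)
      @[n --> \oo] --> g i j z * (d i z + d i z).
    by apply: cvgM; [exact: hz|apply: cvgD; [exact: cvg_sh (hz i)|exact: cvg_cst]].
  rewrite sum3 /u; under eq_fun do rewrite sum3.
  by apply: cvgD; [apply: cvgD|]; exact: c.
have := cvg_cst0_eqr u0 cu.
have -> : \sum_i g i j z * (d i z + d i z) = 2 * \sum_i d i z * g i j z.
  by rewrite !sum3; ring.
by move=> /eqP; rewrite mulf_eq0 pnatr_eq0 /= => /eqP.
Qed.

(** The same argument for <d, g_j> = 0. This holds only almost everywhere, so it is first secured at
    all of the countably many translates of the point. *)
Lemma hessian_normal : {ae mu2, forall z, forall j k,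
  \sum_i (g i j z * g i k z + d i z * h i j k z) = 0}.
Proof.
apply: ae_countable => j; apply: ae_countable => k.
have gs : {ae mu2, forall z, forall n, \sum_i d i (sh k (stp false n) z) * g i j (sh k (stp false n) z) = 0}.
  apply: ae_foralln => n.
  have := mpres_ae (sh_mpres k (stp false n)) grad_tangent.
  by apply: (@filterS _ _ (ae_filter_ringOfSetsType mu2)) => z; apply.
have := ae_and (ae_and (ae_dq_d k) (ae_dq_g j k)) (ae_and grad_tangent gs).
apply: (@filterS _ _ (ae_filter_ringOfSetsType mu2)) => z [[h1 h2] [h3 h4]].
pose u n := \sum_i (g i j (sh k (stp false n) z) * dq k (stp false n) (d i) z +
  d i z * dq k (stp false n) (g i j) z).
have u0 n : u n = 0.
  transitivity ((stp false n)^-1 * (\sum_i d i (sh k (stp false n) z) * g i j (sh k (stp false n) z) -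
     \sum_i d i z * g i j z)).
    by rewrite /u /dq !sum3; ring.
  by rewrite h3 h4 subrr mulr0.
apply: (cvg_cst0_eqr u0).
have c i : g i j (sh k (stp false n) z) * dq k (stp false n) (d i) z +
    d i z * dq k (stp false n) (g i j) z @[n --> \oo] --> g i j z * g i k z + d i z * h i j k z.
  by apply: cvgD; apply: cvgM; [exact: cvg_sh (h2 i)|exact: h1|exact: cvg_cst|exact: h2].
rewrite sum3 /u; under eq_fun do rewrite sum3.
by apply: cvgD; [apply: cvgD|]; exact: c.
Qed.

Lemma hessian_sym : {ae mu2, forall z, forall i, h i ord0 ord_max z = h i ord_max ord0 z}.
Proof.
apply: ae_countable => i.
exact: (weak_mixed_sym (lh i ord0 ord_max) (lh i ord_max ord0) (wd i ord0) (wd i ord_max)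
  (wg i ord0 ord_max) (wg i ord_max ord0)).
Qed.

Let e z := \sum_(i < 3) \sum_(j < 2) g i j z ^+ 2.
Let lap i z := \sum_(j < 2) h i j j z.
Let tau i z := lap i z + e z * d i z.

Let me : measurable_fun setT e.
Proof. by apply: measurable_sum => i; apply: measurable_sum => j; apply: measurable_funX; case: (lg i j). Qed.

Let mlap i : measurable_fun setT (lap i).
Proof. by apply: measurable_sum => j; case: (lh i j j). Qed.

Let mtau i : measurable_fun setT (tau i).
Proof.
apply: measurable_funD; first exact: mlap.
by apply: measurable_funM; [exact: me|exact: md].
Qed.

Lemma lap_integrable : mu2.-integrable setT (fun z => (\sum_i lap i z ^+ 2)%:E).
Proof.
have H i : mu2.-integrable setT (fun z => (lap i z ^+ 2)%:E).
  have i00 := integrable_L2M (Lh i ord0 ord0) (Lh i ord0 ord0).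
  have i11 := integrable_L2M (Lh i ord_max ord_max) (Lh i ord_max ord_max).
  have i01 := integrable_L2M (Lh i ord0 ord0) (Lh i ord_max ord_max).
  have := integrableD measurableT (integrableD measurableT i00 i11) (integrableD measurableT i01 i01).
  apply: eq_integrable => // z _; rewrite -!EFinD; congr (_%:E).
  by rewrite /lap sum2; ring.
have := integrableD measurableT (integrableD measurableT (H ord0) (H (Ordinal (isT : (1 < 3)%N)))) (H i2).
by apply: eq_integrable => // z _; rewrite sum3 !EFinD.
Qed.

Lemma ae_energy_le_lap : {ae mu2, forall z, e z ^+ 2 <= \sum_i lap i z ^+ 2}.
Proof.
apply: (@filterS _ _ (ae_filter_ringOfSetsType mu2) _ _ _ hessian_normal) => z hz.
exact: (@energy_le_lap _ (fun i => d i z) (fun i j => g i j z) (fun i j k => h i j k z) (d1 z) hz).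
Qed.

Lemma energy_integrable : mu2.-integrable setT (fun z => (e z ^+ 2)%:E).
Proof.
have m2 : measurable_fun setT (fun z => (e z ^+ 2)%:E) by apply/measurable_EFinP; exact: measurable_funX.
apply/integrableP; split => //.
have /integrableP[m i] := lap_integrable.
apply: le_lt_trans i; apply: ae_ge0_le_integral => //.
- exact: measurableT_comp.
- exact: measurableT_comp.
apply: (@filterS _ _ (ae_filter_ringOfSetsType mu2) _ _ _ ae_energy_le_lap) => z hz _.
by rewrite /= lee_fin (ger0_norm (sqr_ge0 _)) (le_trans hz)// ler_norm.
Qed.

(** Each g^2 is at most [e], and e^2 is dominated by |lap d|^2, which is integrable. *)
Lemma grad_pow4_lty i j : (\int[mu2]_z (g i j z ^+ 4)%:E < +oo)%E.
Proof.
have [mg _] := lg i j.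
have p4 z : 0 <= g i j z ^+ 4 by rewrite exprn_even_ge0.
have i4 : mu2.-integrable setT (fun z => (g i j z ^+ 4)%:E).
  apply: le_integrable energy_integrable => //.
    by apply/measurable_EFinP; exact: measurable_funX.
  move=> z _ /=; rewrite lee_fin ger0_norm// ger0_norm ?sqr_ge0//.
  rewrite (_ : g i j z ^+ 4 = (g i j z ^+ 2) ^+ 2); last by rewrite -exprM.
  rewrite lerXn2r ?nnegrE ?sqr_ge0//.
    by apply: sumr_ge0 => k _; apply: sumr_ge0 => l _; exact: sqr_ge0.
  rewrite /e (bigD1 i)//= (bigD1 j)//= -addrA lerDl addr_ge0//.
    by apply: sumr_ge0 => l _; exact: sqr_ge0.
  by apply: sumr_ge0 => k _; apply: sumr_ge0 => l _; exact: sqr_ge0.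
exact: (integrable_lty measurableT i4).
Qed.

(** All integrals are finite and are named as reals, so that only linear arithmetic remains
    afterwards. *)
Lemma energy_estimate (eps : R) : 0 < eps -> (forall x, eps <= d i2 x) ->
  exists E L : R, [/\ (\int[mu2]_z (e z ^+ 2)%:E = E%:E)%E,
    (\int[mu2]_z (\sum_i lap i z ^+ 2)%:E = L%:E)%E,
    (\int[mu2]_z (\sum_i tau i z ^+ 2)%:E = (L - E)%:E)%E, 0 <= E &
    E / 4 <= (1 + eps^-1 ^+ 2) * (L - E)].
Proof.
move=> eps0 deps.
have iE := energy_integrable; have iL := lap_integrable.
exists (fine (\int[mu2]_z (e z ^+ 2)%:E)%E), (fine (\int[mu2]_z (\sum_i lap i z ^+ 2)%:E)%E).
have fE := fineK (integrable_fin_num measurableT iE).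
have fL := fineK (integrable_fin_num measurableT iL).
set E := fine _ in fE *; set L := fine _ in fL *.
have iLE := integrableB measurableT iL iE.
have eLE : (\int[mu2]_z ((\sum_i lap i z ^+ 2)%:E - (e z ^+ 2)%:E) = (L - E)%:E)%E.
  by rewrite integralB// EFinB fE fL.
split => //.
- rewrite -eLE; apply: ae_eq_integral => //.
  + apply/measurable_EFinP; apply: measurable_sum => i; apply: measurable_funX.
    exact: mtau.
  + exact: (measurable_int _ iLE).
  + apply: (@filterS _ _ (ae_filter_ringOfSetsType mu2) _ _ _ hessian_normal) => z hz _.
    rewrite -EFinB; congr (_%:E).
    exact: (@tension_norm _ (fun i => d i z) (fun i j => g i j z) (fun i j k => h i j k z) (d1 z) hz).
- by rewrite -lee_fin fE; apply: integral_ge0 => z _; rewrite lee_fin sqr_ge0.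
pose B z := \sum_i (h i ord0 ord_max z * h i ord_max ord0 z - h i ord0 ord0 z * h i ord_max ord_max z).
pose A z := \sum_i \sum_j \sum_k
      ((2 * g i j z * h i j k z * g i2 k z + g i j z ^+ 2 * h i2 k k z) / d i2 z
       - g i j z ^+ 2 * g i2 k z ^+ 2 / d i2 z ^+ 2).
have nB : null_int B.
  apply: null_int_sum => i; exact: (null_lagrangian (Lg i ord0) (Lg i ord_max) (Lh _ _ _) (Lh _ _ _)
    (Lh _ _ _) (Lh _ _ _) (wg i ord0 ord0) (wg i ord0 ord_max) (wg i ord_max ord0) (wg i ord_max ord_max)).
have nA : null_int A.
  apply: null_int_sum => i; apply: null_int_sum => j; apply: null_int_sum => k.
  exact: (null_divergence eps0 (Lg i j) (Lg i2 k) (Lh i j k) (Lh i2 k k) (grad_pow4_lty i j)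
    (grad_pow4_lty i2 k) (md i2) deps (sphere_norm_le1 i2) (wg i j k) (wg i2 k k) (wd i2 k)).
have [iZ Z0] := null_intD (null_intZ 2 nB) (null_intZ (-1) nA).
set c := 1 + eps^-1 ^+ 2.
(* [V] is the right side minus the left side of [pointwise_bound], grouped so that the null terms
   form one summand. *)
pose V z : R := c * (\sum_i lap i z ^+ 2 - e z ^+ 2) + (2 * B z + -1 * A z) + - 4^-1 * e z ^+ 2.
have V0 : {ae mu2, forall z, 0 <= V z}.
  have := ae_and (ae_and grad_tangent hessian_normal) hessian_sym.
  apply: (@filterS _ _ (ae_filter_ringOfSetsType mu2)) => z [[h1 h2] h3].
  have hb := @pointwise_bound _ eps (fun i => d i z) (fun i j => g i j z) (fun i j k => h i j k z)
    eps0 (d1 z) (deps z) h1 h2 h3.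
  have ht := @tension_norm _ (fun i => d i z) (fun i j => g i j z) (fun i j k => h i j k z) (d1 z) h2.
  rewrite ht in hb; rewrite /V -/c /B /A mulN1r mulNr subr_ge0 [4^-1 * _]mulrC.
  by apply: (le_trans hb); rewrite addrA.
have iV : mu2.-integrable setT (EFin \o V).
  have := integrableD measurableT (integrableD measurableT (integrableZl measurableT c iLE) iZ)
    (integrableZl measurableT (- 4^-1) iE).
  by apply: eq_integrable => // z _; rewrite /= -EFinB -!EFinM -!EFinD.
have eV : (\int[mu2]_z (V z)%:E = (c * (L - E) - 4^-1 * E)%:E)%E.
  transitivity (\int[mu2]_z (c%:E * ((\sum_i lap i z ^+ 2)%:E - (e z ^+ 2)%:E) +
      (2 * B z + -1 * A z)%:E + (- 4^-1)%:E * (e z ^+ 2)%:E))%E.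
    by apply: eq_integral => z _; rewrite -EFinB -!EFinM -!EFinD.
  rewrite integralD//; last 2 first.
  - by apply: integrableD => //; exact: integrableZl.
  - exact: integrableZl.
  rewrite integralD//; last exact: integrableZl.
  by rewrite !integralZl// eLE Z0 -fE adde0 -!EFinM -EFinD mulNr.
have : (0 <= \int[mu2]_z (V z)%:E)%E.
  rewrite (_ : (\int[mu2]_z (V z)%:E = \int[mu2]_z `|(V z)%:E|)%E); first exact: integral_ge0.
  apply: ae_eq_integral => //; first exact: (measurable_int _ iV).
    by apply: measurableT_comp => //; exact: (measurable_int _ iV).
  by apply: (@filterS _ _ (ae_filter_ringOfSetsType mu2) _ _ _ V0) => z hz _; rewrite /= ger0_norm.
by rewrite eV lee_fin; lra.
Qed.

End SphereMaps.

Unset Implicit Arguments.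

(* d = (d_i)_{i<3} : R^2 -> S^2; g i j = d_j d_i (weak), h i j k = d_k d_j d_i (weak).
   Integrals are Lebesgue integrals over R^2 with values in \bar R. *)
Theorem theorem1p2 (R : realType) (eps0 C0 : R) :
  0 < eps0 -> 0 < C0 ->
  exists2 delta0 : R, 0 < delta0 &
  forall (d : 'I_3 -> R * R -> R)
         (g : 'I_3 -> 'I_2 -> R * R -> R)
         (h : 'I_3 -> 'I_2 -> 'I_2 -> R * R -> R),
    (* d maps into the unit sphere S^2 *)
    (forall x, \sum_(i < 3) d i x ^+ 2 = 1) ->
    (forall i, measurable_fun [set: R * R] (d i)) ->
    (* nabla d in H^1(R^2): weak first and second derivatives, all in L^2 *)
    (forall i j, weak_pd j (d i) (g i j)) ->
    (forall i j k, weak_pd k (g i j) (h i j k)) ->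
    (forall i j, L2 (g i j)) ->
    (forall i j k, L2 (h i j k)) ->
    (* ||nabla d||_{L^2} <= C0 *)
    (\int[(@leb2 R)]_x ((\sum_(i < 3) \sum_(j < 2) g i j x ^+ 2)%:E)
       <= (C0 ^+ 2)%:E)%E ->
    (* d_3 >= eps0 on R^2 *)
    (forall x, eps0 <= d (Ordinal (isT : (2 < 3)%N)) x) ->
    let grad2 x := \sum_(i < 3) \sum_(j < 2) g i j x ^+ 2 in
    let lap i x := \sum_(j < 2) h i j j x in
    let L4 := (\int[(@leb2 R)]_x ((grad2 x ^+ 2)%:E))%E in
    let Lap2 := (\int[(@leb2 R)]_x ((\sum_(i < 3) lap i x ^+ 2)%:E))%E in
    (L4 <= (1 - delta0)%:E * Lap2)%E /\
    (\int[(@leb2 R)]_x ((\sum_(i < 3) (lap i x + grad2 x * d i x) ^+ 2)%:E)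
       >= (delta0 / 2)%:E * (Lap2 + L4))%E.
Proof.
move=> eps0_gt0 _.
pose q := 4 * (1 + eps0^-1 ^+ 2).
have q0 : 0 < q by have := sqr_ge0 eps0^-1; rewrite /q; lra.
have q1 : 0 < 1 + q by lra.
(* The estimate reads E <= q (L - E); adding L - E to both sides gives L <= (1 + q) (L - E), that is
   E <= (1 - 1 / (1 + q)) L. *)
exists (1 + q)^-1; first by rewrite invr_gt0.
move=> d g h d1 md wd wg Lg Lh _ hd3 grad2 lap L4 Lap2.
have [E [L [eE eL eT E0 hE]]] := energy_estimate d1 md wd wg Lg Lh eps0_gt0 hd3.
have {}hE : E <= q * (L - E).
  by rewrite /q -mulrA; move: hE; move: (_ * (L - E)) => X; lra.
have LE : 0 <= L - E by rewrite -(pmulr_rge0 _ q0); exact: le_trans hE.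
have key : (1 + q)^-1 * L <= L - E.
  by rewrite ler_pdivrMl// mulrDl mul1r; lra.
rewrite /L4 /Lap2 /leb2.
have -> : (\int[@lebesgue_measure R \x @lebesgue_measure R]_x
    (\sum_(i < 3) (lap i x + grad2 x * d i x) ^+ 2)%:E = (L - E)%:E)%E := eT.
have -> : (\int[@lebesgue_measure R \x @lebesgue_measure R]_x
    (\sum_(i < 3) lap i x ^+ 2)%:E = L%:E)%E := eL.
have -> : (\int[@lebesgue_measure R \x @lebesgue_measure R]_x
    (grad2 x ^+ 2)%:E = E%:E)%E := eE.
have r0 : 0 < (1 + q)^-1 by rewrite invr_gt0.
move: (1 + q)^-1 key r0 => r key r0.
rewrite -EFinD -!EFinM !lee_fin; split; first by rewrite mulrBl mul1r; lra.
(* Since E <= L, half of L + E is at most L. *)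
apply: le_trans key; rewrite -mulrA ler_pM2l//; lra.
Qed.
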